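(* Let $\Gamma\in\mathfrak{T}_{0,\Delta}(\mathbf{A},\Psi)$ be a rigid genus $0$ tropical curve, equipped with the flow (orientation of edges) towards a specified sink vertex $V_\infty\in\Gamma^{[0]}$. Inductively associate to each edge $E$ of $\Gamma$ an element, well-defined up to sign, $\zeta_E=z^{n_E}\otimes\alpha_E\in\mathbb{Z}[N]\otimes\Lambda^*M$ as follows: (i) for each $i\in I$, $\zeta_{E_i}:=z^{\Delta(i)}\otimes\alpha_{A_i}$; (ii) if $E_1,\dots,E_k$ are the edges flowing into a vertex $V\neq V_\infty$ and $E_{\mathrm{out}}$ is the edge flowing out of $V$, then $\zeta_{E_{\mathrm{out}}}:=\ell_k(\zeta_{E_1},\dots,\zeta_{E_k})$. Let $\Omega$ be a primitive element of $\Lambda^rN$. Then $$\mathrm{Mult}(\Gamma)=\left|\left\langle\Omega,\prod_{E\ni V_\infty}\zeta_E\right\rangle\right|,$$ where the product $\prod_{E\ni V_\infty}\zeta_E$ lies in $\Lambda^rM=z^0\otimes\Lambda^rM$ and $\langle\cdot,\cdot\rangle$ is the dual pairing.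
   Context: **Lattices.** $N$ is a lattice of finite rank $r$, $M=\mathrm{Hom}(N,\mathbb{Z})$, $N_{\mathbb{R}}=N\otimes\mathbb{R}$. The index of a lattice element $v$ is the integer $k\ge 0$ with $v=kv'$, $v'$ primitive. For $S\subset N_{\mathbb{R}}$, $L(S)$ is the real span of all $u-v$ with $u,v\in S$, and $L_N(S)=L(S)\cap N$. **Tropical curves.** Let $\overline{\Gamma}$ be the topological realization of a finite connected graph, and $\Gamma$ the complement of some set of its univalent vertices. $\Gamma^{[0]},\Gamma^{[1]},\Gamma^{[1]}_\infty,\Gamma^{[1]}_c$ denote the vertices, edges, non-compact edges and compact edges of $\Gamma$; assume $\Gamma^{[0]}\neq\emptyset$. $\Gamma$ carries a weight function $w:\Gamma^{[1]}\to\mathbb{Z}_{\ge0}$, a genus function $g:\Gamma^{[0]}\to\mathbb{Z}_{\ge0}$ (positive at univalent and bivalent vertices) and a marking, i.e. a bijection $\epsilon:I\to\overline{\Gamma}^{[0]}\setminus\Gamma^{[0]}$; $E_i$ is the non-compact edge containing $\epsilon(i)$, and $I^\circ=\{i: w(E_i)=0\}$. A parameterized tropical curve also has a continuous map $h:\Gamma\to N_{\mathbb{R}}$ that is a proper embedding into an affine line of rational slope on each edge with $w(E)>0$, contracts each edge with $w(E)=0$ to a point, and is balanced: $\sum_{E\ni V}w(E)u_{(V,E)}=0$ for all $V\in\Gamma^{[0]}$, where $u_{(V,E)}$ is the primitive integral vector emanating from $h(V)$ into $h(E)$ (and $0$ if $h(E)$ is a point). Contracted compact edges have a length in $\mathbb{R}_{>0}$.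 A tropical curve is an isomorphism class (homeomorphisms respecting weights, genera, markings, $h$). Write $u_i$ for $u_{(\partial E_i,E_i)}$. The genus is $b_1(\Gamma)+\sum_Vg(V)$; the degree is $\Delta:I\to N$, $\Delta(i)=w(E_i)u_i$; the type $\mathfrak{u}$ is the marked weighted graph with genus function and the map $u:(V,E)\mapsto w(E)u_{(V,E)}$ on flags. Set $\mathrm{ov}(V)=\mathrm{val}(V)+3g(V)-3$, $\mathrm{ov}(\Gamma)=\sum_V\mathrm{ov}(V)$, $d^{\mathrm{trop}}_{g,\mathfrak{u}}=\#I+(r-3)(1-g)-\mathrm{ov}(\Gamma)$. A curve of type $\mathfrak{u}$ is non-superabundant if it has no contracted loops or higher-genus vertices and the space of curves of type $\mathfrak{u}$ has dimension $d^{\mathrm{trop}}_{g,\mathfrak{u}}$. **Constraints and rigidity.** An affine constraint $\mathbf{A}=(A_i)_{i\in I}$ is a tuple of rational-slope affine subspaces of $N_{\mathbb{R}}$, where $A_i$ may carry a weight $w_i\in\mathbb{Z}_{\geq1}$ (default $1$). A curve matches $\mathbf{A}$ if $h(E_i)\subset A_i$ for all $i$; it satisfies $\Psi=(s_i)_{i\in I^\circ}\in\mathbb{Z}_{\ge0}^{I^\circ}$ if $\mathrm{ov}(V)\ge\sum_{i\in I^\circ,\,E_i\ni V}s_i$ for each $V$. $\mathfrak{T}_{g,\Delta}(\mathbf{A},\Psi)$ is the space of marked tropical curves of genus $g$, degree $\Delta$, matching $\mathbf{A}$ and satisfying $\Psi$. $\Gamma\in\mathfrak{T}_{g,\Delta}(\mathbf{A},\Psi)$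 is rigid if $\mathbf{A}$ is generic (generic translates), $\Gamma$ is non-superabundant and $\sum_i\mathrm{codim}(A_i)=d^{\mathrm{trop}}_{g,\mathfrak{u}}$; then it is an isolated point. **Multiplicity.** With $\partial^\pm E$ an arbitrary labelling of the endpoints of a compact edge and $L_N(E):=L_N(h(E))$, let $$\Phi:\prod_{V\in\Gamma^{[0]}}N\to\prod_{E\in\Gamma_c^{[1]}}N/L_N(E)\times\prod_{i\in I}N/L_N(A_i),\quad H\mapsto((H_{\partial^+E}-H_{\partial^-E})_E,(H_{\partial E_i})_i).$$ For rigid $\Gamma$ this is a finite-index inclusion. $\mathfrak{D}_\Gamma$ is its index and $\mathrm{Mult}(\Gamma)=\mathfrak{D}_\Gamma\prod_{E\in\Gamma^{[1]}_c}w(E)$, multiplied by $\prod_iw_i$ if the $A_i$ carry weights. **Brackets.** On $A=\mathbb{Z}[N]\otimes\Lambda^*M$, with product $(z^{n_1}\alpha_1)(z^{n_2}\alpha_2)=z^{n_1+n_2}\alpha_1\wedge\alpha_2$, let $\ell_1(z^n\alpha)=z^n\iota_n(\alpha)$ ($\iota_n$ being the contraction, the antiderivation of $\Lambda^*M$ with $\iota_n(m)=\langle n,m\rangle$ for $m\in M$), and $\ell_k(z^{n_1}\alpha_1,\dots,z^{n_k}\alpha_k)=\ell_1(\prod_jz^{n_j}\alpha_j)=z^{n_1+\cdots+n_k}\iota_{n_1+\cdots+n_k}(\alpha_1\wedge\cdots\wedge\alpha_k)$, extended multilinearly. **The forms $\alpha_{A_i}$.** $\alpha_{A_i}\in\Lambda^{\mathrm{codim}A_i}M$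 is the unique-up-to-sign simple element of index $w_i$ (the weight of $A_i$) that vanishes on $L(A_i)$, i.e. $w_i$ times the wedge of a basis of $L(A_i)^\perp\cap M$. **Flow.** $\Gamma$ is a tree, and every edge is oriented towards $V_\infty$; every vertex other than $V_\infty$ has exactly one outgoing edge. *)

(* Defs.v *)
From HB Require Import structures.
From mathcomp Require Import all_boot all_order all_algebra.
From mathcomp Require Import finmap monalg.
From mathcomp Require Import boolp reals.

Set Implicit Arguments.
Unset Strict Implicit.
Unset Printing Implicit Defensive.

Import Order.TTheory GRing.Theory Num.Theory.
Local Open Scope ring_scope.

(* Conventions: N = Z^r is the type 'rV[int]_r of row vectors, M = Hom(N, Z)   *)
(* is the type 'cV[int]_r of column vectors, paired by <n, m> = (n *m m) 0 0,  *)
(* and N_R is 'rV[R]_r.                                                        *)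

Definition eq_up_to_sign (V : zmodType) (x y : V) : Prop := x = y \/ x = - y.

(* The zero vector is not primitive: take k = 0. *)
Definition primitive (V : zmodType) (v : V) : Prop :=
  forall (k : nat) (v' : V), v = v' *+ k -> k = 1%N.

(* [G : P] when finite, and 0 otherwise; P is meant to be a subgroup of G. *)
Definition has_index (G : zmodType) (P : G -> Prop) (k : nat) : Prop :=
  exists s : seq G,
    [/\ size s = k,
        forall i j, (i < k)%N -> (j < k)%N -> P (s`_i - s`_j) -> i = j
      & forall g, exists2 x, x \in s & P (g - x)].

Definition subgroup_index (G : zmodType) (P : G -> Prop) : nat :=
  if pselect (exists k, has_index P k) is left ex then projT1 (cid ex) else 0%N.

(* ---------------------------------------------------------------------- *)
(* Exterior algebras                                                      *)
(* ---------------------------------------------------------------------- *)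

(* The exterior algebra of Z^r in coordinates: the entry at S of an element is *)
(* its coefficient on e_S := e_{j_1} /\ ... /\ e_{j_p}, where S consists of    *)
(* j_1 < ... < j_p. It serves both for the exterior algebra of M and for that  *)
(* of N, on the standard basis of Z^r and its dual basis.                      *)
Definition ext (r : nat) := {ffun {set 'I_r} -> int}.

Section ExteriorAlgebra.
Variable r : nat.

Definition homogeneous (p : nat) (a : ext r) : Prop :=
  forall S : {set 'I_r}, a S != 0 -> #|S| = p.

Definition ext_one : ext r := [ffun S : {set 'I_r} => (S == set0)%:Z].

Definition ext_covector (m : 'cV[int]_r) : ext r :=
  [ffun S : {set 'I_r} => \sum_j (S == [set j])%:Z * m j 0].

Definition inversions (T U : {set 'I_r}) : nat :=
  #|[set p : 'I_r * 'I_r | [&& p.1 \in T, p.2 \in U & (p.2 < p.1)%N]]|.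

(* e_T /\ e_U = (-1)^(inversions T U) e_(T U) if T and U are disjoint, else 0. *)
Definition wedge (a b : ext r) : ext r :=
  [ffun S : {set 'I_r} => \sum_(T : {set 'I_r} | T \subset S)
     (-1) ^+ inversions T (S :\: T) * a T * b (S :\: T)].

(* iota_n e_{j_1 ... j_p} = \sum_q (-1)^(q-1) n_{j_q} e_{j_1 ... ^j_q ... j_p} *)
Definition contract (n : 'rV[int]_r) (a : ext r) : ext r :=
  [ffun S : {set 'I_r} => \sum_(j | j \notin S)
     (-1) ^+ #|[set k in S | (k < j)%N]| * n 0 j * a (j |: S)].

(* Pairing of the exterior algebra of N with that of M, for which (e_S) and    *)
(* (e_S) are dual bases.                                                       *)
Definition ext_pairing (a b : ext r) : int := \sum_S a S * b S.

(* ---------------------------------------------------------------------- *)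
(* Z[N] (x) Lambda^* M and its brackets                                   *)
(* ---------------------------------------------------------------------- *)

(* Finitely supported functions from N to Lambda^* M: the value at n is the    *)
(* coefficient of z^n. (The ring structure of the monalg library does not      *)
(* apply, as it requires a monoid of exponents without invertible elements.)   *)
Definition polyvec := {malg (ext r)['rV[int]_r]}.

Definition zmon (n : 'rV[int]_r) (a : ext r) : polyvec := << a *g n >>.

Definition pv_mul (x y : polyvec) : polyvec :=
  \sum_(n1 <- msupp x) \sum_(n2 <- msupp y)
     zmon (n1 + n2) (wedge x@_n1 y@_n2).

Definition pv_prod (zs : seq polyvec) : polyvec :=
  \big[pv_mul/zmon 0 ext_one]_(z <- zs) z.

Definition ell1 (x : polyvec) : polyvec :=
  \sum_(n <- msupp x) zmon n (contract n x@_n).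

(* ell_k, with k the length of the sequence of arguments *)
Definition ell (zs : seq polyvec) : polyvec := ell1 (pv_prod zs).

End ExteriorAlgebra.

(* ---------------------------------------------------------------------- *)
(* Graphs and tropical curves                                             *)
(* ---------------------------------------------------------------------- *)

(* The graph Gamma. Its non-compact edges are exactly the E_i, so they are     *)
(* indexed by the marking set I; [root i] is the vertex of E_i in Gamma.       *)
(* The edge set of Gamma is the disjoint sum cedge + I. For compact edges      *)
(* [src] and [tgt] name the two endpoints in an arbitrary order; loops and     *)
(* multiple edges are allowed.                                                 *)
Record mgraph (I : finType) := MGraph {
  vert : finType;
  cedge : finType;
  src : cedge -> vert;
  tgt : cedge -> vert;
  root : I -> vert;
  cweight : cedge -> nat;
  lweight : I -> nat;
  vgenus : vert -> nat }.

Section Graph.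
Variables (I : finType) (G : mgraph I).
Implicit Types (v x y : vert G) (e : cedge G).

Definition joins e x y : bool :=
  ((src e == x) && (tgt e == y)) || ((src e == y) && (tgt e == x)).

Definition adjacent : rel (vert G) := [rel x y | [exists e, joins e x y]].

Definition adjacent_without e : rel (vert G) :=
  [rel x y | [exists e', (e' != e) && joins e' x y]].

(* number of flags at v with compact edge in C; a loop contributes 2 *)
Definition cvalence (C : {set cedge G}) v : nat :=
  (#|[set e in C | src e == v]| + #|[set e in C | tgt e == v]|)%N.

Definition valence v : nat :=
  (cvalence [set: cedge G] v + #|[set i | root G i == v]|)%N.

Definition ov v : int := (valence v)%:Z + 3 * (vgenus v)%:Z - 3.

(* b_1 of a connected graph plus the vertex genera; as Gamma retracts onto its *)
(* compact part, b_1 = 1 - (#vertices - #compact edges).                       *)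
Definition curve_genus : int :=
  1 - #|vert G|%:Z + #|cedge G|%:Z + \sum_(v : vert G) (vgenus v)%:Z.

Definition dtrop (r : nat) : int :=
  #|I|%:Z + (r%:Z - 3) * (1 - curve_genus) - \sum_(v : vert G) ov v.

(* A loop is a connected non-empty subgraph all of whose vertices have valence *)
(* 2; a non-empty edge set with all valences 0 or 2 is a disjoint union of     *)
(* such, so connectedness need not be imposed to rule out contracted loops.    *)
Definition no_contracted_loop : Prop :=
  forall C : {set cedge G}, C != set0 -> (forall e, e \in C -> cweight e = 0%N) ->
    ~ (forall v, cvalence C v = 0%N \/ cvalence C v = 2%N).

Definition no_higher_genus_vertex : Prop := forall v, vgenus v = 0%N.

(* In a tree, e is oriented towards its endpoint that is still connected to    *)
(* Vinf once e is removed.                                                     *)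
Definition flows_into (Vinf v : vert G) (E : cedge G + I) : bool :=
  match E with
  | inl e => ((src e == v) || (tgt e == v)) && connect (adjacent_without e) v Vinf
  | inr i => root G i == v
  end.

Definition flows_out (Vinf v : vert G) (e : cedge G) : bool :=
  ((src e == v) || (tgt e == v)) && ~~ connect (adjacent_without e) v Vinf.

Definition incident v (E : cedge G + I) : bool :=
  match E with
  | inl e => (src e == v) || (tgt e == v)
  | inr i => root G i == v
  end.

End Graph.

(* The combinatorial type. [cdir e] is u_(src e, e) and - cdir e is            *)
(* u_(tgt e, e), the endpoints of a non-contracted edge seeing opposite        *)
(* directions; [ldir i] is u_i.                                                *)
Record trop_type (r : nat) (I : finType) := TropType {
  tgraph :> mgraph I;
  cdir : cedge tgraph -> 'rV[int]_r;
  ldir : I -> 'rV[int]_r;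
  tt_nonempty : (0 < #|vert tgraph|)%N;
  tt_connected : forall x y : vert tgraph, connect (@adjacent I tgraph) x y;
  tt_genus : forall v : vert tgraph,
    valence v = 1%N \/ valence v = 2%N -> (0 < vgenus v)%N;
  tt_cdir : forall e, if cweight e == 0%N then cdir e = 0 else primitive (cdir e);
  tt_ldir : forall i,
    if lweight tgraph i == 0%N then ldir i = 0 else primitive (ldir i);
  tt_balanced : forall v : vert tgraph,
    \sum_(e | src e == v) cdir e *+ cweight e
    - \sum_(e | tgt e == v) cdir e *+ cweight e
    + \sum_(i | root tgraph i == v) ldir i *+ lweight tgraph i = 0 }.

Section Curves.
Variables (R : realType) (r : nat) (I : finType).

Definition toR (m n : nat) (A : 'M[int]_(m, n)) : 'M[R]_(m, n) := map_mx intr A.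

(* Positions of the vertices and (lattice) lengths of the compact edges. For a *)
(* non-contracted edge the length is determined by the positions.              *)
Definition realization (T : trop_type r I) : vectType R :=
  ({ffun vert T -> 'rV[R]_r} * {ffun cedge T -> R^o})%type.

Definition realizes (T : trop_type r I) (p : realization T) : Prop :=
  forall e : cedge T,
    (0 < p.2 e) /\ p.1 (tgt e) - p.1 (src e) = (p.2 e : R) *: toR (cdir e).

(* A parameterized tropical curve. The map h is affine on every edge: a        *)
(* compact edge goes to the segment between the images of its endpoints, and   *)
(* E_i goes to the ray h(root i) + R_{>=0} u_i (a point if E_i is contracted). *)
Record trop_curve := TropCurve {
  ctype :> trop_type r I;
  creal : realization ctype;
  creal_ok : realizes creal }.

Definition position (Gam : trop_curve) : vert Gam -> 'rV[R]_r :=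
  fun v => (creal Gam).1 v.

(* The dimension of a convex set S is that of the span L(S) of the differences *)
(* of its elements.                                                            *)
Definition convex_dim (vT : vectType R) (S : vT -> Prop) (d : int) : Prop :=
  exists U : {vspace vT},
    [/\ forall x y, S x -> S y -> x - y \in U,
        forall W : {vspace vT},
          (forall x y, S x -> S y -> x - y \in W) -> (U <= W)%VS
      & (\dim U)%:Z = d].

Definition non_superabundant (Gam : trop_curve) : Prop :=
  [/\ no_contracted_loop Gam, no_higher_genus_vertex Gam
    & convex_dim (@realizes Gam) (dtrop Gam r)].

(* An affine constraint is A_i = a i + L(A_i), with weight w i. The rational   *)
(* linear space L(A_i) is given as the real row space of the matrix D i.       *)
Definition dirspace (D : 'M[rat]_r) : 'M[R]_r := map_mx ratr D.

Definition in_affine (a : 'rV[R]_r) (D : 'M[rat]_r) (x : 'rV[R]_r) : Prop :=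
  (x - a <= dirspace D)%MS.

Definition codim (D : 'M[rat]_r) : nat := (r - \rank (dirspace D))%N.

(* L_N = L :&: N for L the row space of a real matrix *)
Definition in_LN (m : nat) (L : 'M[R]_(m, r)) (n : 'rV[int]_r) : Prop :=
  (toR n <= L)%MS.

Definition matches (a : {ffun I -> 'rV[R]_r}) (D : I -> 'M[rat]_r)
    (Gam : trop_curve) : Prop :=
  forall (i : I) (t : R), 0 <= t ->
    in_affine (a i) (D i) (position (root Gam i) + t *: toR (ldir Gam i)).

(* Only the values of Psi on I° = {i | w(E_i) = 0} are used. *)
Definition satisfies_psi (Psi : I -> nat) (Gam : trop_curve) : Prop :=
  forall v : vert Gam,
    (\sum_(i | (lweight Gam i == 0%N) && (root Gam i == v)) Psi i)%:Z <= ov v.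

(* membership in T_{g, Delta}(A, Psi) *)
Definition in_moduli (g : nat) (Delta : I -> 'rV[int]_r)
    (a : {ffun I -> 'rV[R]_r}) (D : I -> 'M[rat]_r) (Psi : I -> nat)
    (Gam : trop_curve) : Prop :=
  [/\ curve_genus Gam = g%:Z,
      forall i, ldir Gam i *+ lweight Gam i = Delta i,
      matches a D Gam & satisfies_psi Psi Gam].

(* Rigidity, apart from the genericity of the translates, which is expressed   *)
(* by [for_generic].                                                           *)
Definition rigid (D : I -> 'M[rat]_r) (Gam : trop_curve) : Prop :=
  non_superabundant Gam /\ (\sum_i codim (D i))%:Z = dtrop Gam r.

(* P holds outside of finitely many proper linear subspaces *)
Definition for_generic (vT : vectType R) (P : vT -> Prop) : Prop :=
  exists2 Bs : seq {vspace vT},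
    (forall B, B \in Bs -> B != fullv)
    & forall a, (forall B, B \in Bs -> a \notin B) -> P a.

(* The index of the image of Phi in the product of the N/L_N(E) and the        *)
(* N/L_N(A_i), computed as that of its preimage in the product of copies of N. *)
Definition frakD (D : I -> 'M[rat]_r) (Gam : trop_curve) : nat :=
  @subgroup_index ({ffun cedge Gam -> 'rV[int]_r} * {ffun I -> 'rV[int]_r})%type
    (fun g => exists H : {ffun vert Gam -> 'rV[int]_r},
       (forall e : cedge Gam,
          in_LN (position (tgt e) - position (src e))
                (g.1 e - (H (tgt e) - H (src e))))
       /\ (forall i, in_LN (dirspace (D i)) (g.2 i - H (root Gam i)))).

Definition mult (D : I -> 'M[rat]_r) (w : I -> nat) (Gam : trop_curve) : nat :=
  (frakD D Gam * (\prod_(e : cedge Gam) cweight e) * (\prod_i w i))%N.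

(* The columns of B form a basis of the lattice of the m in M vanishing on L. *)
Definition perp_basis (D : 'M[rat]_r) (c : nat) (B : 'M[int]_(r, c)) : Prop :=
  forall m : 'cV[int]_r,
    dirspace D *m toR m = 0 <-> exists! x : 'cV[int]_c, m = B *m x.

Definition constraint_form (D : 'M[rat]_r) (w : nat) (alpha : ext r) : Prop :=
  exists (c : nat) (B : 'M[int]_(r, c)), perp_basis D B /\
    eq_up_to_sign alpha
      ((\big[@wedge r/ext_one r]_(k < c) ext_covector (col k B)) *+ w).

(* The inductive rules determine every zeta E up to sign only, so all choices  *)
(* of signs and all orderings s of the edges flowing into v are admitted.      *)
Definition flow_elements (D : I -> 'M[rat]_r) (w : I -> nat)
    (Delta : I -> 'rV[int]_r) (Gam : trop_curve) (Vinf : vert Gam)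
    (zeta : cedge Gam + I -> polyvec r) : Prop :=
  (forall i, exists2 alpha, constraint_form (D i) (w i) alpha
                          & zeta (inr i) = zmon (Delta i) alpha)
  /\ (forall (v : vert Gam) (e : cedge Gam), v != Vinf -> flows_out Vinf v e ->
        exists2 s, perm_eq s (enum (flows_into Vinf v))
                 & eq_up_to_sign (zeta (inl e)) (ell [seq zeta E | E <- s])).

End Curves.

(* Main.v *)
(* Let E be the set of compact edges. As the graph is a tree, a map H from its vertices
   to N amounts to the point x = H(Vinf) and the differences of H along the edges; hence
   the index D_Gamma is that of the image of
     N x Z^E -> prod_i N / L_N(A_i),   (x, t) |-> (x + sum_e t_e u_e)_i,
   the sum being over the edges e on the path from E_i to Vinf. Replacing u_e by
   n_e = +- w(e) u_e multiplies this index by prod_e w(e), so that Mult(Gamma) is the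
   absolute value of the determinant of the resulting map, i.e. of the coefficient in top
   degree of the wedge product T over i of the pullbacks of the forms alpha_{A_i} to
   N x Z^E. This coefficient can be computed by first contracting T with the basis
   vectors of Z^E, the leaves of the tree first, and then pairing with Omega. As iota is
   an antiderivation compatible with pullbacks, each contraction performs one bracket of
   rule (ii), and the product of the zeta_E at Vinf remains. *)

Require Import Defs.
From HB Require Import structures.
From mathcomp Require Import all_boot all_order all_algebra.
From mathcomp Require Import finmap monalg reals.
From mathcomp Require Import ring zify.

Set Implicit Arguments.
Unset Strict Implicit.
Unset Printing Implicit Defensive.

Import Order.TTheory GRing.Theory Num.Theory.
Local Open Scope ring_scope.

(** * Exterior algebras *)

(** Forms are compared up to sign throughout: the brackets, the orderings of the factors and the
    labelling of the endpoints determine no more, and only an absolute value is wanted in the end.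
    The delicate point of the contraction is that each factor is a form in the position of one
    particular vertex, and that it depends on the length t_e only if e lies on the path from this
    vertex to Vinf. Going from the deepest edges upwards, the contraction along e meets only the
    factors at the lower end of e. Their contracted product is killed by iota_{u_e}, so it does not
    notice the displacement t_e u_e and can be read as a form in the position of the upper end; this
    is what lets the recursion continue. The Smith normal form links the index to the determinant.
    It also covers an infinite index, which counts as 0 just when the determinant vanishes. The
    matrix is square only through the dimension count, r + #E parameters against the sum of the
    codimensions, so the determinant is taken as a coefficient of a wedge of columns, which makes
    sense for any shape. *)

Lemma inversionsE r (T U : {set 'I_r}) :
  inversions T U = (\sum_(i in T) \sum_(j in U) (j < i))%N.
Proof.
rewrite /inversions -sum1_card pair_big /= big_mkcond [RHS]big_mkcond /=.
apply: eq_bigr => -[i j] _ /=; rewrite inE /=.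
by case: (i \in T); case: (j \in U); case: (j < i)%N.
Qed.

Lemma sum_disjointU (J : finType) (A B : {set J}) (F : J -> nat) : [disjoint A & B] ->
  (\sum_(i in A :|: B) F i = \sum_(i in A) F i + \sum_(i in B) F i)%N.
Proof. by move=> dAB; rewrite -bigU //; apply: eq_bigl => i; rewrite !inE. Qed.

Lemma inversionsUl r (T1 T2 U : {set 'I_r}) : [disjoint T1 & T2] ->
  inversions (T1 :|: T2) U = (inversions T1 U + inversions T2 U)%N.
Proof. by move=> dT; rewrite !inversionsE sum_disjointU. Qed.

Lemma inversionsUr r (T U1 U2 : {set 'I_r}) : [disjoint U1 & U2] ->
  inversions T (U1 :|: U2) = (inversions T U1 + inversions T U2)%N.
Proof.
move=> dU; rewrite !inversionsE -big_split.
by apply: eq_bigr => i _; apply: sum_disjointU.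
Qed.

Lemma inversions0l r (U : {set 'I_r}) : inversions set0 U = 0%N.
Proof. by rewrite inversionsE big_set0. Qed.

Lemma inversions0r r (T : {set 'I_r}) : inversions T set0 = 0%N.
Proof. by rewrite inversionsE big1 // => i _; rewrite big_set0. Qed.

Lemma inversions1l r (j : 'I_r) (S : {set 'I_r}) :
  inversions [set j] S = #|[set k in S | (k < j)%N]|.
Proof.
rewrite inversionsE big_set1 -sum1_card big_mkcond [RHS]big_mkcond /=.
by apply: eq_bigr => k _; rewrite inE; case: (k \in S); case: (k < j)%N.
Qed.

(** Each pair in T x U is an inversion in exactly one of the two orders. This gives the sign
    (-1)^(pq) of graded commutativity. *)
Lemma inversionsC r (T U : {set 'I_r}) : [disjoint T & U] ->
  (inversions T U + inversions U T = #|T| * #|U|)%N.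
Proof.
move=> dTU; rewrite !inversionsE [X in (_ + X)%N]exchange_big -big_split /=.
rewrite (eq_bigr (fun=> #|U|)); first by rewrite sum_nat_const.
move=> i iT; rewrite -big_split /= -sum1_card; apply: eq_bigr => j jU.
have : i != j by apply: contraTneq dTU => ij; apply/pred0Pn; exists i; rewrite /= iT ij.
by rewrite -val_eqE /= neq_ltn; case: (ltngtP i j).
Qed.

Section Wedge.
Variable r : nat.
Implicit Types a b c : ext r.

Lemma wedge1x a : wedge (ext_one r) a = a.
Proof.
apply/ffunP=> S; rewrite ffunE (bigD1 set0) ?sub0set //= ffunE eqxx setD0.
rewrite inversions0l mulr1 mul1r big1 ?addr0 // => T /andP[_ /negPf TS].
by rewrite ffunE TS mulr0 mul0r.
Qed.

Lemma wedgex1 a : wedge a (ext_one r) = a.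
Proof.
apply/ffunP=> S; rewrite ffunE (bigD1 S) //= ffunE setDv eqxx.
rewrite inversions0r mulr1 mul1r big1 ?addr0 // => T /andP[TS nTS].
rewrite ffunE; case: eqP => [/eqP|_]; last by rewrite mulr0.
by rewrite setD_eq0 => ST; rewrite eqEsubset TS ST in nTS.
Qed.

Lemma wedge_is_zmod_morphism a : zmod_morphism (wedge a).
Proof.
move=> b c; apply/ffunP=> S; rewrite !ffunE -sumrB; apply: eq_bigr => T _.
by rewrite !ffunE mulrBr.
Qed.
HB.instance Definition _ a :=
  GRing.isZmodMorphism.Build _ _ (@wedge r a) (wedge_is_zmod_morphism a).

Lemma wedgeBl b : zmod_morphism (fun a => wedge a b).
Proof.
move=> a c; apply/ffunP=> S; rewrite !ffunE -sumrB; apply: eq_bigr => T _.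
by rewrite !ffunE mulrBr mulrBl.
Qed.

(** The product with its arguments swapped, so that additivity in the left factor can also be
    registered as a morphism. *)
Definition wedgel b a := wedge a b.
HB.instance Definition _ b :=
  GRing.isZmodMorphism.Build _ _ (wedgel b) (wedgeBl b).

(** Both sides run over the partitions of S into three blocks U, W, X, and additivity of
    [inversions] in each argument makes both signs the product of the signs of the three pairs of
    blocks. *)
Lemma wedgeA : associative (@wedge r).
Proof.
move=> a b c; apply/ffunP=> S; rewrite !ffunE; apply/esym.
pose F T U : int := (-1) ^+ inversions T (S :\: T) * (-1) ^+ inversions U (T :\: U)
  * (a U * b (T :\: U) * c (S :\: T)).
transitivity (\sum_(T : {set 'I_r} | T \subset S)
                \sum_(U : {set 'I_r} | U \subset T) F T U).
  apply: eq_bigr => T _; rewrite ffunE big_distrr big_distrl /=.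
  by apply: eq_bigr => U _; rewrite /F; ring.
rewrite (exchange_big_dep (fun U : {set 'I_r} => U \subset S)) /=; last first.
  by move=> T U TS UT; apply: subset_trans TS.
apply: eq_bigr => U US; rewrite ffunE big_distrr /=.
(* On the left the blocks are given by the chain U, T, S; the middle block is W = T minus U. *)
rewrite (reindex_onto (fun W => U :|: W) (fun T => T :\: U)) /=; last first.
  move=> T /andP[_ UT]; rewrite setUC setDE setUIl [~: U :|: U]setUC setUCr setIT.
  by apply/setUidPl.
apply: eq_big => [W | W /andP[/andP[UWS _] /eqP WU]].
  rewrite subUset US /=.
  rewrite setDUl setDv set0U subsetD subsetUl andbT; congr (_ && _).
  exact: (sameP eqP setDidPl).
have dUW : [disjoint U & W] by rewrite -WU -setI_eq0 setIC setDE setIAC -setIA setICr setI0.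
rewrite /F WU -setDDl; set X := _ :\: W.
have dUX : [disjoint U & X].
  by rewrite -setI_eq0 /X !setDE [S :&: _]setIC -!setIA setIA setICr set0I.
have dWX : [disjoint W & X].
  by rewrite -setI_eq0 /X !setDE [_ :&: ~: W]setIC setIA setICr set0I.
have -> : S :\: U = W :|: X.
  rewrite /X; apply/setP => x; rewrite !inE.
  move/subsetP: UWS => /(_ x); rewrite inE.
  move: dUW; rewrite disjoints_subset => /subsetP /(_ x); rewrite inE.
  by case: (x \in U); case: (x \in W); case: (x \in S) => //= H1 H2;
    first [have := H1 isT | have := H2 isT].
rewrite inversionsUl // inversionsUr // !exprD; ring.
Qed.

HB.instance Definition _ := Monoid.isLaw.Build (ext r) (ext_one r) (@wedge r)
  wedgeA wedge1x wedgex1.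

Lemma wedge0x a : wedge 0 a = 0. Proof. exact: (raddf0 (wedgel a)). Qed.
Lemma wedgex0 a : wedge a 0 = 0. Proof. exact: raddf0. Qed.
Lemma wedgeNx a b : wedge (- a) b = - wedge a b. Proof. exact: (raddfN (wedgel b)). Qed.
Lemma wedgexN a b : wedge a (- b) = - wedge a b. Proof. exact: raddfN. Qed.
Lemma wedgeDx a b c : wedge (a + b) c = wedge a c + wedge b c.
Proof. exact: (raddfD (wedgel c)). Qed.
Lemma wedgeMz a b z : wedge (a *~ z) b = wedge a b *~ z.
Proof. exact: (raddfMz (wedgel b)). Qed.

Lemma ext_mulrzE a z S : (a *~ z) S = a S * z.
Proof.
case: z => n; first by rewrite -pmulrn ffunMnE -[RHS]mulrzz.
by rewrite NegzE -nmulrn ffunE ffunMnE mulrN -[_ * _]mulrzz.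
Qed.

Lemma wedge_covector (m : 'cV_r) a S :
  wedge (ext_covector m) a S =
  \sum_(j in S) (-1) ^+ #|[set k in S | (k < j)%N]| * m j 0 * a (S :\ j).
Proof.
rewrite ffunE (bigID (fun T => T \in [set [set j] | j in S])) /=.
rewrite [X in _ + X]big1 ?addr0; last first.
  move=> T /andP[TS nT]; rewrite ffunE big1 ?mulr0 ?mul0r // => j _.
  case: eqP => [TE|]; last by rewrite mul0r.
  by case/imsetP: nT; exists j => //; rewrite -sub1set -TE.
rewrite (eq_bigl (fun T => T \in [set [set j] | j in S])); last first.
  move=> T; apply: andb_idl => /imsetP[j jS ->]; by rewrite sub1set.
rewrite big_imset /=; last by move=> i j _ _; apply: set1_inj.
apply: eq_bigr => j jS; rewrite inversions1l ffunE.
rewrite (bigD1 j) //= eqxx mul1r big1 ?addr0; last first.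
  by move=> i ij; rewrite (inj_eq set1_inj) eq_sym (negPf ij) mul0r.
do 3 f_equal; apply: eq_card => k; rewrite !inE.
by case: (altP (k =P j)) => [->|] //=; rewrite ltnn andbF.
Qed.

Lemma ext_covector_is_zmod_morphism : zmod_morphism (@ext_covector r).
Proof.
move=> m m'; apply/ffunP => S; rewrite !ffunE -sumrB.
by apply: eq_bigr => j _; rewrite !mxE mulrBr.
Qed.
HB.instance Definition _ :=
  GRing.isZmodMorphism.Build _ _ (@ext_covector r) ext_covector_is_zmod_morphism.

End Wedge.
Section Basis.
Variable r : nat.
Implicit Types a b c : ext r.

Definition ext_basis (S : {set 'I_r}) : ext r := [ffun T => (T == S)%:Z].

Lemma ext_basis0 : ext_basis set0 = ext_one r.
Proof. by apply/ffunP=> S; rewrite !ffunE. Qed.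

Lemma ext_decomp a : a = \sum_S ext_basis S *~ a S.
Proof.
apply/ffunP=> T; rewrite sum_ffunE (bigD1 T) //= ext_mulrzE ffunE eqxx mul1r.
by rewrite big1 ?addr0 // => S; rewrite ext_mulrzE ffunE eq_sym => /negPf->; rewrite mul0r.
Qed.

Lemma covector_delta_basis j S :
  wedge (ext_covector (delta_mx j 0)) (ext_basis S) =
  if j \in S then 0 else ext_basis (j |: S) *~ (-1) ^+ #|[set k in S | (k < j)%N]|.
Proof.
apply/ffunP => T; rewrite wedge_covector.
transitivity (if j \in T then
   (-1) ^+ #|[set k in T | (k < j)%N]| * (T :\ j == S)%:Z else 0 : int).
  case: ifP => [jT|njT].
    rewrite (bigD1 j) //= mxE ffunE !eqxx mulr1 big1 ?addr0 // => i /andP[_ /negPf ij].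
    by rewrite mxE ij mulr0 mul0r.
  rewrite big1 // => i iT; rewrite mxE; case: eqP => [ij|]; last by rewrite mulr0 mul0r.
  by rewrite -ij iT in njT.
case: ifP => jT; case: ifP => jS.
- rewrite ffunE; case: eqP => [TE|]; last by rewrite mulr0.
  by rewrite -TE !inE eqxx in jS.
- rewrite ext_mulrzE ffunE mulrC; case: (altP (T =P j |: S)) => [->|nT].
    rewrite setU1K ?jS // eqxx !mul1r; congr (_ ^+ _); apply: eq_card => k.
    by rewrite !inE; case: eqP => [->|] //=; rewrite ltnn andbF.
  rewrite mul0r; case: eqP => [TE|]; last by rewrite mul0r.
  by case/eqP: nT; rewrite -TE setD1K.
- by rewrite ffunE.
- rewrite ext_mulrzE ffunE; case: eqP => [TE|]; last by rewrite mul0r.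
  by rewrite TE setU11 in jT.
Qed.

(** Products of covectors span the exterior algebra. Identities about contractions and pullbacks
    thereby reduce to multiplying by one covector on the left, where no sign depending on a degree
    occurs. *)
Lemma ext_ind (Q : ext r -> Prop) :
    Q (ext_one r) -> (forall a b, Q a -> Q b -> Q (a + b)) ->
    (forall a z, Q a -> Q (a *~ z)) ->
    (forall m a, Q a -> Q (wedge (ext_covector m) a)) -> forall a, Q a.
Proof.
move=> Q1 QD QM QW a; rewrite (ext_decomp a).
apply: big_ind => [||S _]; [by rewrite -(mulr0z (ext_one r)); apply: QM | exact: QD |].
apply: (QM); have [p] := ubnP #|S|; elim: p => // p IHp in S *; rewrite ltnS => Sp.
have [->|[j jS]] := set_0Vmem S; first by rewrite ext_basis0.
have := covector_delta_basis j (S :\ j); rewrite setD11 setD1K // => E.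
have -> : ext_basis S = wedge (ext_covector (delta_mx j 0)) (ext_basis (S :\ j))
            *~ (-1) ^+ #|[set k in S :\ j | (k < j)%N]|.
  by rewrite E -mulrzA -expr2 sqrr_sign mulr1z.
by apply/QM/QW/IHp; move: Sp; rewrite (cardsD1 j) jS.
Qed.

Lemma contract_is_zmod_morphism n : zmod_morphism (@contract r n).
Proof.
move=> a b; apply/ffunP => S; rewrite !ffunE -sumrB; apply: eq_bigr => j _.
by rewrite !ffunE mulrBr.
Qed.
HB.instance Definition _ n :=
  GRing.isZmodMorphism.Build _ _ (@contract r n) (contract_is_zmod_morphism n).

Lemma contract0l a : contract 0 a = 0.
Proof. by apply/ffunP => S; rewrite !ffunE big1 // => j _; rewrite mxE mulr0 mul0r. Qed.

Lemma contract1 n : contract n (ext_one r) = 0.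
Proof.
apply/ffunP => S; rewrite !ffunE big1 // => j _; rewrite ffunE.
by case: eqP => [/setP/(_ j)|]; rewrite ?mulr0 // !inE eqxx.
Qed.

(** At S both sides are double sums over an index j inserted by the contraction and an index i
    removed by the wedge. The terms with i = j make up the pairing, with j outside S coming from the
    left side and j in S from the right. The other terms match with opposite signs, since exactly
    one of i < j and j < i holds. *)
Lemma contract_covector (n : 'rV_r) (m : 'cV_r) a :
  contract n (wedge (ext_covector m) a) =
  a *~ (n *m m) 0 0 - wedge (ext_covector m) (contract n a).
Proof.
pose lt (j : 'I_r) (S : {set 'I_r}) := #|[set k in S | (k < j)%N]|.
have ltU i j (S : {set 'I_r}) : i \notin S -> lt j (i |: S) = ((i < j) + lt j S)%N.
  move=> iS; have -> : lt j (i |: S) = (\sum_(k in i |: S) (k < j))%N.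
    by rewrite /lt -sum1_card big_mkcond [RHS]big_mkcond /=; apply: eq_bigr => k _;
      rewrite !inE; case: eqP => //=; case: (k \in S); case: (k < j)%N.
  rewrite big_setU1 //=; congr addn.
  by rewrite /lt -sum1_card big_mkcond [RHS]big_mkcond /=; apply: eq_bigr => k _;
      rewrite !inE; case: (k \in S); case: (k < j)%N.
apply/ffunP => S; rewrite [LHS]ffunE [RHS]ffunE ext_mulrzE [X in _ = _ + X]ffunE.
rewrite wedge_covector.
pose F (i j : 'I_r) : int := (-1) ^+ lt j S * n 0 j * ((-1) ^+ lt i (j |: S :\ i) * m i 0 *
  a (j |: S :\ i)).
transitivity (\sum_(j | j \notin S) n 0 j * m j 0 * a S
              + \sum_(j | j \notin S) \sum_(i in S) F i j).
  rewrite -big_split /=; apply: eq_bigr => j jS; rewrite wedge_covector.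
  rewrite big_setU1 //= mulrDr; congr (_ + _).
    rewrite setU1K // -/(lt j S) -/(lt j (j |: S)) ltU // ltnn add0n.
    transitivity ((-1) ^+ lt j S * (-1) ^+ lt j S * (n 0 j * m j 0 * a S) : int).
      by ring.
    by rewrite -expr2 sqrr_sign mul1r.
  rewrite big_distrr /=; apply: eq_bigr => i iS; rewrite /F.
  have ij : i != j by apply: contraNneq jS => <-.
  have -> : (j |: S) :\ i = j |: S :\ i.
    by apply/setP => k; rewrite !inE; case: (k =P j) => // ->; rewrite eq_sym ij.
  congr (_ * (_ ^+ _ * _ * _)); rewrite -/(lt i (j |: S)).
  rewrite -[in LHS](setD1K iS) setUCA ltU ?ltnn //.
  by rewrite !inE eqxx orbF (negPf ij).
transitivity (\sum_j n 0 j * m j 0 * a S - \sum_(i in S) n 0 i * m i 0 * a S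
              + \sum_(i in S) \sum_(j | j \notin S) F i j).
  rewrite exchange_big /=; congr (_ + _); rewrite [X in _ = X - _](bigID (mem S)) /=.
  by rewrite addrAC subrr add0r.
rewrite mxE big_distrr /= -addrA; congr (_ + _).
  by apply: eq_bigr => j _; rewrite mulrC.
rewrite addrC -sumrB -sumrN; apply: eq_bigr => i iS; rewrite ffunE.
rewrite [in RHS](bigD1 i) ?setD11 //= setD1K // mulrDr opprD [RHS]addrC.
have lti : lt i S = lt i (S :\ i) by rewrite -{1}(setD1K iS) ltU ?setD11 // ltnn.
congr (_ + _); last first.
  rewrite -/(lt i S) -/(lt i (S :\ i)) -lti.
  transitivity (- ((-1) ^+ lt i S * (-1) ^+ lt i S * (n 0 i * m i 0 * a S)) : int).
    by rewrite -expr2 sqrr_sign mul1r.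
  by ring.
rewrite big_distrr -sumrN /=; apply: eq_big => [j|j jS].
  by rewrite !inE negb_and negbK; case: (j =P i) => [->|]; rewrite ?iS ?andbT.
have ij : i != j by apply: contraNneq jS => <-.
rewrite /F -/(lt i S) -/(lt j (S :\ i)) ltU ?inE ?negb_and ?jS ?orbT // -lti.
rewrite -{1}(setD1K iS) ltU ?setD11 // !exprD.
have : (-1) ^+ (i < j) * (-1) ^+ (j < i) = -1 :> int.
  by move: ij; rewrite -val_eqE /= neq_ltn; case: (ltngtP i j).
set x : int := (-1) ^+ (i < j); set y : int := (-1) ^+ (j < i) => E.
transitivity (x * y * ((-1) ^+ lt j (S :\ i) * (-1) ^+ lt i S * n 0 j * m i 0 *
   a (j |: S :\ i))); first by ring.
by rewrite E; ring.
Qed.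

(** In the Leibniz rule the term with a sign depending on the degree of [a] is the one that vanishes
    here. *)
Lemma contract_wedgel n a b : contract n b = 0 ->
  contract n (wedge a b) = wedge (contract n a) b.
Proof.
move=> nb; elim/ext_ind: a => [|a a' IHa IHa'|a z IHa|m a IHa].
- by rewrite wedge1x nb contract1 wedge0x.
- by rewrite wedgeDx !raddfD /= wedgeDx IHa IHa'.
- by rewrite wedgeMz !raddfMz /= wedgeMz IHa.
by rewrite -wedgeA !contract_covector IHa wedgeDx wedgeNx wedgeMz wedgeA.
Qed.

Lemma contractK n a : contract n (contract n a) = 0.
Proof.
elim/ext_ind: a => [|a b IHa IHb|a z IHa|m a IHa].
- by rewrite contract1 raddf0.
- by rewrite !raddfD /= IHa IHb addr0.
- by rewrite !raddfMz /= IHa mul0rz.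
rewrite contract_covector raddfB /= contract_covector IHa raddf0 subr0.
by rewrite raddfMz subrr.
Qed.

(** By degree only two-element sets {i, j} can carry a coefficient, and there m_i m_j occurs once
    with each sign. *)
Lemma covectorK m a : wedge (ext_covector m) (wedge (ext_covector m) a) = 0.
Proof.
have E : wedge (ext_covector m) (ext_covector m) = 0 :> ext r; last first.
  by rewrite wedgeA E wedge0x.
apply/ffunP => S; rewrite wedge_covector ffunE.
have cE i : ext_covector m [set i] = m i 0.
  rewrite ffunE (bigD1 i) //= eqxx mul1r big1 ?addr0 // => j ij.
  by rewrite (inj_eq set1_inj) eq_sym (negPf ij) mul0r.
have [/cards2P[i [j [ij ->]]]|S2] := boolP (#|S| == 2).
  rewrite big_setU1 ?inE //= big_set1.
  have -> : [set i; j] :\ i = [set j].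
    by apply/setP => k; rewrite !inE; case: (k =P i) => // ->; rewrite (negPf ij).
  have -> : [set i; j] :\ j = [set i].
    apply/setP => k; rewrite !inE; case: (k =P j) => [->|]; last by rewrite orbF.
    by rewrite eq_sym (negPf ij).
  rewrite !cE; set p := #|_|; set q := #|_|.
  have E x y : x != y :> 'I_r ->
      #|[set k in [set x; y] | (k < x)%N]| = (y < x)%N.
    move=> xy; case: (ltnP y x) => yx.
      rewrite /= -(cards1 y); apply: eq_card => k; rewrite !inE.
      case: (k =P x) => [->|_]; first by rewrite ltnn (negPf xy).
      by case: (k =P y) => //= ->.
    apply: eq_card0 => k; rewrite !inE; case: (k =P x) => [->|_]; first by rewrite ltnn.
    by case: (k =P y) => //= ->; rewrite ltnNge yx.
  rewrite /p /q E // setUC E; last by rewrite eq_sym.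
  move: ij; rewrite -val_eqE /= neq_ltn.
  by case: (ltngtP i j) => //= _ _; rewrite ?expr0 ?expr1; ring.
rewrite big1 // => i iS; rewrite [X in _ * X]ffunE big1 ?mulr0 // => j _.
case: eqP => [SE|]; last by rewrite mul0r.
by move: S2; rewrite (cardsD1 i) iS SE cards1.
Qed.

(** Polarization: expand the square of m + m'. *)
Lemma covectorC m m' a : wedge (ext_covector m) (wedge (ext_covector m') a) =
  - wedge (ext_covector m') (wedge (ext_covector m) a).
Proof.
have := covectorK (m + m') a; rewrite raddfD /= !wedgeDx !raddfD /= !covectorK.
by rewrite add0r addr0 => /eqP; rewrite addr_eq0 => /eqP.
Qed.

End Basis.
Section UpToSign.
Implicit Types V W : zmodType.

Lemma eqs_refl V (x : V) : eq_up_to_sign x x. Proof. by left. Qed.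

Lemma eqs_sym V (x y : V) : eq_up_to_sign x y -> eq_up_to_sign y x.
Proof. by case=> ->; [left | right; rewrite opprK]. Qed.

Lemma eqs_trans V (x y z : V) :
  eq_up_to_sign x y -> eq_up_to_sign y z -> eq_up_to_sign x z.
Proof.
by case=> ->; case=> ->; rewrite ?opprK; [left | right | right | left].
Qed.

Lemma eqs_opp V (x : V) : eq_up_to_sign (- x) x. Proof. by right. Qed.

Lemma eqs_mulz_sign V (x : V) z k : eq_up_to_sign (x *~ (z * (-1) ^+ k)) (x *~ z).
Proof.
rewrite -signr_odd; case: (odd k); rewrite ?mulr1 ?mulrN1; last by left.
by right; rewrite mulrNz.
Qed.

Lemma eqs_raddf V W (f : {additive V -> W}) x y :
  eq_up_to_sign x y -> eq_up_to_sign (f x) (f y).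
Proof. by case=> ->; [left | right; rewrite raddfN]. Qed.

Lemma eqs_norm (x y : int) : eq_up_to_sign x y -> `|x| = `|y|.
Proof. by case=> ->; rewrite ?normrN. Qed.

Variable r : nat.
Implicit Types a b : ext r.

Lemma eqs_wedge a a' b b' : eq_up_to_sign a a' -> eq_up_to_sign b b' ->
  eq_up_to_sign (wedge a b) (wedge a' b').
Proof.
by case=> ->; case=> ->; rewrite ?wedgeNx ?wedgexN ?opprK; [left|right|right|left].
Qed.

Lemma eqs_coef a b S : eq_up_to_sign a b -> eq_up_to_sign (a S) (b S).
Proof. by case=> ->; [left | right; rewrite ffunE]. Qed.

Lemma eqs_bigwedge (J : Type) (s : seq J) (P : pred J) (F G : J -> ext r) :
  (forall j, P j -> eq_up_to_sign (F j) (G j)) ->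
  eq_up_to_sign (\big[@wedge r/ext_one r]_(j <- s | P j) F j)
                (\big[@wedge r/ext_one r]_(j <- s | P j) G j).
Proof.
move=> FG; elim/big_ind2: _ => [|x y u v|]; [exact: eqs_refl | exact: eqs_wedge | exact: FG].
Qed.

End UpToSign.

(** * Homogeneous forms and graded commutativity *)

Section Homogeneous.
Variable r : nat.
Implicit Types a b : ext r.

Lemma homogeneous1 : homogeneous 0 (ext_one r).
Proof. by move=> S; rewrite ffunE; case: (S =P set0) => // -> _; rewrite cards0. Qed.

Lemma homogeneous_covector m : homogeneous 1 (@ext_covector r m).
Proof.
move=> S; rewrite ffunE; apply: contra_neq_eq => S1; rewrite big1 // => j _.
case: eqP => [SE|]; last by rewrite mul0r.
by rewrite SE cards1 in S1.
Qed.

Lemma homogeneous0 p : homogeneous p (0 : ext r).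
Proof. by move=> S; rewrite ffunE eqxx. Qed.

Lemma homogeneousD p a b : homogeneous p a -> homogeneous p b -> homogeneous p (a + b).
Proof.
move=> ha hb S; rewrite ffunE; have [->|/ha//] := eqVneq (a S) 0.
by rewrite add0r; apply: hb.
Qed.

Lemma homogeneousMz p a z : homogeneous p a -> homogeneous p (a *~ z).
Proof. by move=> ha S; rewrite ext_mulrzE mulf_eq0 negb_or => /andP[/ha]. Qed.

Lemma homogeneousN p a : homogeneous p a -> homogeneous p (- a).
Proof. by rewrite -mulrN1z; apply: homogeneousMz. Qed.

Lemma homogeneous_eqs p a b : eq_up_to_sign a b -> homogeneous p b -> homogeneous p a.
Proof. by case=> -> //; apply: homogeneousN. Qed.

Lemma homogeneous_wedge p q a b :
  homogeneous p a -> homogeneous q b -> homogeneous (p + q) (wedge a b).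
Proof.
move=> ha hb S; rewrite ffunE; apply: contra_neq_eq => Spq.
rewrite big1 // => T TS; have [->|/ha aT] := eqVneq (a T) 0; first by rewrite mulr0 mul0r.
have [->|/hb bT] := eqVneq (b (S :\: T)) 0; first by rewrite mulr0.
by rewrite -(cardsID T S) (setIidPr TS) aT bT eqxx in Spq.
Qed.

Lemma homogeneous_contract p n a : homogeneous p a -> homogeneous p.-1 (contract n a).
Proof.
move=> ha S; rewrite ffunE; apply: contra_neq_eq => Sp.
rewrite big1 // => j jS; have [->|/ha aS] := eqVneq (a (j |: S)) 0; first by rewrite mulr0.
by rewrite -aS cardsU1 jS eqxx in Sp.
Qed.

Lemma homogeneous_bigwedge (J : Type) (s : seq J) (F : J -> ext r) (p : J -> nat) :
  (forall j, homogeneous (p j) (F j)) ->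
  homogeneous (\sum_(j <- s) p j) (\big[@wedge r/ext_one r]_(j <- s) F j).
Proof.
move=> hF; elim: s => [|j s IHs]; first by rewrite !big_nil; apply: homogeneous1.
by rewrite !big_cons; apply: homogeneous_wedge.
Qed.

Lemma homogeneous_top a : homogeneous r a -> a = ext_basis setT *~ a setT.
Proof.
move=> ha; apply/ffunP => S; rewrite ext_mulrzE ffunE.
have [->|ST] := eqVneq S setT; first by rewrite mul1r.
rewrite mul0r; apply: contraNeq ST => /ha Sr.
by rewrite eqEcard subsetT cardsT card_ord Sr /=.
Qed.

(** Exchanging a subset of S with its complement matches the two sums, and [inversionsC] shows that
    the signs differ by the constant (-1)^(pq). *)
Lemma wedgeC_homogeneous p q a b : homogeneous p a -> homogeneous q b ->
  eq_up_to_sign (wedge a b) (wedge b a).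
Proof.
move=> ha hb; suff -> : wedge a b = wedge b a *~ (1 * (-1) ^+ (p * q)).
  exact: eqs_trans (eqs_mulz_sign _ _ _) (eqs_refl _).
apply/ffunP => S; rewrite ext_mulrzE mul1r !ffunE big_distrl /=.
rewrite (reindex_onto (fun T => S :\: T) (fun T => S :\: T)) /=; last first.
  by move=> T TS; rewrite setDDr setDv set0U; apply/setIidPr.
apply: eq_big => [T|T /andP[_ /eqP TE]].
  rewrite subsetDl setDDr setDv set0U /=; apply/eqP/idP => [<-|/setIidPr//].
  exact: subsetIl.
rewrite TE; have [->|/ha aT] := eqVneq (a (S :\: T)) 0; first by rewrite !(mulr0, mul0r).
have [->|/hb bT] := eqVneq (b T) 0; first by rewrite !(mulr0, mul0r).
have dT : [disjoint S :\: T & T] by rewrite -setI_eq0 setDE -setIA [_ :&: T]setIC setICr setI0.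
rewrite -aT -bT -inversionsC // exprD.
set x := (-1) ^+ inversions T _; set y := (-1) ^+ inversions _ T.
have xx : x * x = 1 :> int by rewrite -expr2 sqrr_sign.
transitivity (y * (x * x) * a (S :\: T) * b T); last by ring.
by rewrite xx mulr1.
Qed.

(** This absorbs the arbitrary orderings of the edges at a vertex. *)
Lemma bigwedge_perm (J : eqType) (s t : seq J) (F : J -> ext r) :
    (forall j, exists p, homogeneous p (F j)) -> perm_eq s t ->
  eq_up_to_sign (\big[@wedge r/ext_one r]_(j <- s) F j)
                (\big[@wedge r/ext_one r]_(j <- t) F j).
Proof.
move=> /boolp.choice[p hp].
elim: s t => [|x s IHs] t st; first by rewrite perm_sym in st; rewrite (perm_nilP st); left.
have xt : x \in t by rewrite -(perm_mem st) mem_head.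
case/splitPr: xt st => t1 t2; rewrite perm_sym perm_catC /= perm_cons perm_catC perm_sym.
move=> /IHs {}IHs; rewrite big_cons big_cat /= big_cons.
apply: eqs_trans (eqs_wedge (eqs_refl _) IHs) _; rewrite big_cat /= !wedgeA.
apply: eqs_wedge (eqs_refl _).
by apply: wedgeC_homogeneous (hp x) _; apply: homogeneous_bigwedge.
Qed.

End Homogeneous.

(** * Functoriality and determinants *)

Section Pullback.

Lemma wedge_suml r (J : Type) (s : seq J) (P : pred J) (F : J -> ext r) a :
  wedge (\sum_(j <- s | P j) F j) a = \sum_(j <- s | P j) wedge (F j) a.
Proof. exact: (raddf_sum (wedgel a)). Qed.

(** The pullback of the basis form e_S, restricted to the indices listed in [l]. The list is a
    parameter so that the product can be cut at a given index. *)
Definition bigcov n r (P : 'M[int]_(n, r)) (l : seq 'I_r) (S : {set 'I_r}) : ext n :=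
  \big[@wedge n/ext_one n]_(j <- l | j \in S) ext_covector (col j P).

(* The ring morphism of exterior algebras induced by the map of dual lattices
   m |-> P *m m. *)
Definition pullback n r (P : 'M[int]_(n, r)) (a : ext r) : ext n :=
  \sum_S bigcov P (index_enum 'I_r) S *~ a S.

Lemma pullback_is_zmod_morphism n r (P : 'M[int]_(n, r)) : zmod_morphism (pullback P).
Proof.
by move=> a b; rewrite -sumrB; apply: eq_bigr => S _; rewrite !ffunE mulrzBr.
Qed.
HB.instance Definition _ n r (P : 'M[int]_(n, r)) :=
  GRing.isZmodMorphism.Build _ _ (pullback P) (pullback_is_zmod_morphism P).

Lemma covectorZ r z (m : 'cV[int]_r) : ext_covector (z *: m) = ext_covector m *~ z.
Proof.
apply/ffunP => S; rewrite ext_mulrzE !ffunE big_distrl /=.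
by apply: eq_bigr => j _; rewrite !mxE; ring.
Qed.

Lemma pullback_basis n r (P : 'M[int]_(n, r)) S :
  pullback P (ext_basis S) = bigcov P (index_enum 'I_r) S.
Proof.
rewrite /pullback (bigD1 S) //= ffunE eqxx big1 ?addr0 // => T /negPf TS.
by rewrite ffunE TS.
Qed.

Lemma bigcovU1 n r (P : 'M[int]_(n, r)) l j S : j \notin l ->
  bigcov P l (j |: S) = bigcov P l S.
Proof.
move=> jl; rewrite /bigcov big_seq_cond [RHS]big_seq_cond; apply: eq_bigl => k.
case: (boolP (k \in l)) => //= kl; rewrite !inE; case: (k =P j) kl => //= ->.
by rewrite (negPf jl).
Qed.

Lemma bigcov_insert n r (P : 'M[int]_(n, r)) (m : 'cV[int]_n) l S a :
  wedge (ext_covector m) (wedge (bigcov P l S) a) =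
  wedge (bigcov P l S) (wedge (ext_covector m) a) *~ (-1) ^+ count (mem S) l.
Proof.
rewrite /bigcov; elim: l => [|j l IHl] /=; first by rewrite big_nil !wedge1x.
rewrite big_cons; case: ifP => jS; last by rewrite add0n.
by rewrite -!wedgeA covectorC IHl raddfMz -mulrNz exprD expr1 mulN1r.
Qed.

(** By linearity m = e_j and a = e_S. Moving the column j to its place among the columns of S costs
    the same sign as inserting j into S, and if j is already in S the column occurs twice. *)
Lemma pullback_covector n r (P : 'M[int]_(n, r)) m a :
  pullback P (wedge (ext_covector m) a) = wedge (ext_covector (P *m m)) (pullback P a).
Proof.
have -> : m = \sum_j m j 0 *: delta_mx j 0.
  rewrite {1}[m]matrix_sum_delta; apply: eq_bigr => j _; exact: big_ord1.
rewrite mulmx_sumr (raddf_sum (@ext_covector r)) (raddf_sum (@ext_covector n)).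
rewrite !wedge_suml (raddf_sum (pullback P)).
apply: eq_bigr => j _; rewrite -scalemxAr /= !covectorZ !wedgeMz raddfMz /=.
congr (_ *~ _); rewrite -colE [a]ext_decomp (raddf_sum (wedge _)) !(raddf_sum (pullback P)).
rewrite [RHS](raddf_sum (wedge _)); apply: eq_bigr => S _; rewrite !raddfMz /=; congr (_ *~ _).
rewrite covector_delta_basis pullback_basis.
(* Cut the enumeration at j: the part l1 consists of the indices below j, so the factors of S in it
   number the exponent of the sign. *)
have [l1 [l2 [El l1j]]] : exists l1 l2, index_enum 'I_r = l1 ++ j :: l2 /\
    forall T : {set 'I_r}, count (mem T) l1 = #|[set k in T | (k < j)%N]|.
  exists (take j (enum 'I_r)), (drop j.+1 (enum 'I_r)); split.
    have -> : index_enum 'I_r = enum 'I_r by rewrite [LHS]unlock enumT.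
    by rewrite -[LHS](cat_take_drop j) (drop_nth j) ?size_enum_ord // nth_ord_enum.
  move=> T; have -> : #|[set k in T | (k < j)%N]| =
      count (mem [set k in T | (k < j)%N]) (enum 'I_r).
    by rewrite enumT cardE /enum_mem size_filter.
  rewrite -[in RHS](cat_take_drop j (enum 'I_r)) count_cat.
  rewrite [X in (_ + X)%N](eq_in_count (a2 := pred0)).
    rewrite count_pred0 addn0; apply: eq_in_count => k; rewrite !inE => kj.
    suff -> : (k < j)%N by rewrite andbT.
    have /(nthP j)[i] := kj; rewrite size_takel ?size_enum_ord ?(ltnW (ltn_ord j)) // => ij.
    rewrite nth_take // => <-; rewrite nth_enum_ord //; exact: ltn_trans ij (ltn_ord j).
  move=> k; rewrite !inE => kj; apply/negbTE; rewrite negb_and -leqNgt orbC.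
  have /(nthP j)[i] := kj; rewrite size_drop size_enum_ord nth_drop => ij <-.
  by rewrite nth_enum_ord ?leq_addr // -ltn_subRL.
have := index_enum_uniq 'I_r; rewrite {1}El cat_uniq /= negb_or.
move=> /and4P[_ /andP[jl1 _] jl2 _].
have bigE (T : {set 'I_r}) : bigcov P (index_enum 'I_r) T =
    wedge (bigcov P l1 T) (bigcov P (j :: l2) T).
  by rewrite El /bigcov big_cat.
rewrite bigE bigcov_insert l1j; case: ifP => jS.
  by rewrite raddf0 /bigcov big_cons jS covectorK wedgex0 mul0rz.
rewrite raddfMz /= pullback_basis bigE bigcovU1 //; congr (wedge _ _ *~ _).
by rewrite /bigcov !big_cons jS setU11 -/(bigcov P l2 _) bigcovU1.
Qed.

Lemma pullback1 n r (P : 'M[int]_(n, r)) : pullback P (ext_one r) = ext_one n.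
Proof.
by rewrite -ext_basis0 pullback_basis /bigcov big1 // => j; rewrite inE.
Qed.

Lemma pullback_wedge n r (P : 'M[int]_(n, r)) a b :
  pullback P (wedge a b) = wedge (pullback P a) (pullback P b).
Proof.
elim/ext_ind: a => [|a a' IHa IHa'|a z IHa|m a IHa].
- by rewrite pullback1 !wedge1x.
- by rewrite wedgeDx !raddfD /= wedgeDx IHa IHa'.
- by rewrite wedgeMz !raddfMz /= wedgeMz IHa.
by rewrite -wedgeA !pullback_covector IHa wedgeA.
Qed.

Lemma pullback_bigwedge n r (P : 'M[int]_(n, r)) (J : Type) (s : seq J) (F : J -> ext r) :
  pullback P (\big[@wedge r/ext_one r]_(j <- s) F j) =
  \big[@wedge n/ext_one n]_(j <- s) pullback P (F j).
Proof.
by elim: s => [|j s IHs]; rewrite ?big_nil ?pullback1 // !big_cons pullback_wedge IHs.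
Qed.

Lemma pullback_cov n r (P : 'M[int]_(n, r)) m :
  pullback P (ext_covector m) = ext_covector (P *m m).
Proof. by rewrite -[ext_covector m]wedgex1 pullback_covector pullback1 wedgex1. Qed.

Lemma contract_pullback n r (P : 'M[int]_(n, r)) v a :
  contract v (pullback P a) = pullback P (contract (v *m P) a).
Proof.
elim/ext_ind: a => [|a b IHa IHb|a z IHa|m a IHa].
- by rewrite pullback1 !contract1 raddf0.
- by rewrite !raddfD /= IHa IHb.
- by rewrite !raddfMz /= IHa.
rewrite pullback_covector !contract_covector IHa raddfB /= raddfMz /= pullback_covector.
by rewrite mulmxA.
Qed.

Lemma pullback_comp n m r (A : 'M[int]_(n, m)) (B : 'M[int]_(m, r)) a :
  pullback A (pullback B a) = pullback (A *m B) a.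
Proof.
elim/ext_ind: a => [|a b IHa IHb|a z IHa|v a IHa].
- by rewrite !pullback1.
- by rewrite !raddfD /= IHa IHb.
- by rewrite !raddfMz /= IHa.
by rewrite !pullback_covector IHa mulmxA.
Qed.

Lemma pullback_id r a : pullback (1%:M : 'M_r) a = a.
Proof.
elim/ext_ind: a => [|a b IHa IHb|a z IHa|m a IHa].
- by rewrite pullback1.
- by rewrite !raddfD /= IHa IHb.
- by rewrite !raddfMz /= IHa.
by rewrite pullback_covector IHa mul1mx.
Qed.

Lemma pullback_coef0 n r (P : 'M[int]_(n, r)) a : pullback P a set0 = a set0.
Proof.
elim/ext_ind: a => [|a b IHa IHb|a z IHa|m a IHa].
- by rewrite pullback1 !ffunE !eqxx.
- by rewrite raddfD !ffunE IHa IHb.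
- by rewrite raddfMz !ext_mulrzE IHa.
by rewrite pullback_covector !wedge_covector !big_set0.
Qed.

Lemma homogeneous_bigcov n r (P : 'M[int]_(n, r)) (S : {set 'I_r}) :
  homogeneous #|S| (bigcov P (index_enum 'I_r) S).
Proof.
rewrite /bigcov big_mkcond /= -sum1_card big_mkcond.
apply: homogeneous_bigwedge => j.
by case: ifP => _; [apply: homogeneous_covector | apply: homogeneous1].
Qed.

Lemma homogeneous_pullback n r (P : 'M[int]_(n, r)) p a :
  homogeneous p a -> homogeneous p (pullback P a).
Proof.
move=> ha; rewrite /pullback; elim/big_ind: _ => [|x y|S _].
- exact: homogeneous0.
- exact: homogeneousD.
have [->|/ha <-] := eqVneq (a S) 0; first by rewrite mulr0z; apply: homogeneous0.
exact/homogeneousMz/homogeneous_bigcov.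
Qed.

End Pullback.

(** * Determinants as coefficients in top degree *)

Section Volume.

Lemma bigcovT n r (P : 'M[int]_(n, r)) :
  bigcov P (index_enum 'I_r) setT = \big[@wedge n/ext_one n]_(j < r) ext_covector (col j P).
Proof. by rewrite /bigcov; apply: eq_bigl => j; apply: in_setT. Qed.

(* For [n = m] this is the determinant; only its multiplicativity and its values
   on diagonal matrices are needed, thanks to the Smith normal form. *)
Definition vol n m (Q : 'M[int]_(n, m)) : int :=
  (\big[@wedge n/ext_one n]_(k < m) ext_covector (col k Q)) setT.

Lemma homogeneous_colwedge n m (Q : 'M[int]_(n, m)) :
  homogeneous m (\big[@wedge n/ext_one n]_(k < m) ext_covector (col k Q)).
Proof.
rewrite -{1}(card_ord m) -sum1_card.
by apply: homogeneous_bigwedge => j; apply: homogeneous_covector.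
Qed.

Lemma pullback_colwedge n m p (A : 'M[int]_(n, m)) (Q : 'M[int]_(m, p)) :
  pullback A (\big[@wedge m/ext_one m]_(k < p) ext_covector (col k Q)) =
  \big[@wedge n/ext_one n]_(k < p) ext_covector (col k (A *m Q)).
Proof.
rewrite pullback_bigwedge; apply: eq_bigr => k _.
by rewrite pullback_cov !colE mulmxA.
Qed.

(** Top forms are multiples of e_{1..n}, and the pullback along A multiplies the coefficient by
    [vol A]. The dimensions are tied by an equation because r + #E and the number of constraint
    columns are not convertible. *)
Lemma volM n m p (A : 'M[int]_(p, n)) (Q : 'M[int]_(n, m)) :
  n = m -> vol (A *m Q) = vol A * vol Q.
Proof.
move=> nm; case: m / nm Q => Q.
rewrite /vol -pullback_colwedge (homogeneous_top (@homogeneous_colwedge _ _ Q)).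
rewrite raddfMz /= !ext_mulrzE pullback_basis bigcovT.
by rewrite [ext_basis _ _]ffunE eqxx mul1r.
Qed.

Lemma vol_diag n (Q : 'M[int]_n) : (forall i j, i != j -> Q i j = 0) ->
  vol Q = \prod_i Q i i.
Proof.
move=> diagQ; transitivity (((ext_basis setT : ext n) *~ \prod_i Q i i) setT : int); last first.
  by rewrite ext_mulrzE ffunE eqxx mul1r.
rewrite -[ext_basis _]pullback_id pullback_basis bigcovT /vol.
suff -> : \big[@wedge n/ext_one n]_(k < n) ext_covector (col k Q) =
    \big[@wedge n/ext_one n]_(k < n) ext_covector (col k 1%:M) *~ \prod_i Q i i by [].
have colQ k : ext_covector (col k Q) = ext_covector (col k 1%:M) *~ Q k k.
  rewrite -covectorZ; congr ext_covector; apply/matrixP => i j; rewrite !mxE.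
  by case: (altP (i =P k)) => [->|/diagQ->]; rewrite ?mulr1 ?mulr0.
elim: (index_enum _) => [|k s IHs]; first by rewrite !big_nil.
by rewrite !big_cons colQ wedgeMz IHs raddfMz /= mulrzA mulrzAC.
Qed.

Lemma vol1 n : vol (1%:M : 'M_n) = 1.
Proof.
rewrite vol_diag => [|i j ij]; last by rewrite mxE (negPf ij).
by rewrite big1 // => i _; rewrite mxE eqxx.
Qed.

Lemma norm_vol_unit n (Q : 'M[int]_n) : Q \in unitmx -> `|vol Q| = 1.
Proof.
move=> Qu; have := volM Q (invmx Q) erefl; rewrite mulmxV // vol1.
move/(congr1 absz); rewrite abszM => /esym/eqP; rewrite muln_eq1 => /andP[/eqP]; lia.
Qed.

End Volume.
(** * Lattice indices *)

Section SubgroupIndex.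
Variables (G : zmodType) (P : G -> Prop).

(** Sending each representative in s to one of its class in s' is injective, so two transversals
    have the same length. *)
Lemma has_index_leq k k' : (forall x y, P x -> P y -> P (x - y)) ->
  has_index P k -> has_index P k' -> (k <= k')%N.
Proof.
move=> PB [s [_ s_inj _]] [s' [ss' _ s'_cov]].
have /boolp.choice[f fP] : forall i : 'I_k, exists j : 'I_k', P (s`_i - s'`_j).
  move=> i; have [x /(nthP 0)[j]] := s'_cov s`_i.
  by rewrite ss' => jk' <-; exists (Ordinal jk').
rewrite -(card_ord k) -(card_ord k'); apply: (@leq_card _ _ f) => i j fij.
apply/val_inj/s_inj; rewrite ?ltn_ord //; have := fP j; rewrite -fij => Pj.
by have := PB _ _ (fP i) Pj; rewrite opprB addrA subrK.
Qed.

Lemma subgroup_indexE k : (forall x y, P x -> P y -> P (x - y)) ->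
  has_index P k -> subgroup_index P = k.
Proof.
move=> PB Pk; rewrite /subgroup_index; case: boolp.pselect => [ex|[]]; last by exists k.
case: (boolp.cid ex) => k' /= Pk'.
by apply/eqP; rewrite eqn_leq !(@has_index_leq _ _ PB).
Qed.

Lemma subgroup_index_infinite : (forall k, ~ has_index P k) -> subgroup_index P = 0%N.
Proof.
by move=> nP; rewrite /subgroup_index; case: boolp.pselect => // ex; have [k /nP] := ex.
Qed.

Lemma has_index_classes (T : finType) (f : G -> T) : (forall t, exists g, f g = t) ->
  (forall g h, P (g - h) <-> f g = f h) -> has_index P #|T|.
Proof.
move=> /boolp.choice[g gK] fP; exists [seq g t | t <- enum T]; split.
- by rewrite size_map -cardE.
- rewrite cardE => i j iT jT; have x0 : T by case: (enum T) iT => // x.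
  rewrite (@nth_map _ x0 _ 0 g _ (enum T)) // (@nth_map _ x0 _ 0 g _ (enum T)) // => /fP.
  rewrite !gK => /eqP.
  by rewrite nth_uniq ?enum_uniq // => /eqP.
by move=> h; exists (g (f h)); [apply/map_f/mem_enum | apply/fP; rewrite gK].
Qed.

(** Write Q = L D U with L, U unimodular and D diagonal. In the coordinates [F g] of f g U^-1,
    membership in P becomes divisibility of the k-th coordinate by d_k for every k, so that the
    quotient is the product of the Z/d_k. *)
Theorem subgroup_index_vol n m (Q : 'M[int]_(n, m)) (f : G -> 'rV[int]_m) : n = m ->
  (forall g h, f (g - h) = f g - f h) -> (forall y, exists g, f g = y) ->
  (forall g, P g <-> exists x, f g = x *m Q) ->
  subgroup_index P = `|vol Q|%N.
Proof.
move=> nm; case: m / nm Q f => Q f fB f_surj PE.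
have [L Lu [U Uu [d _ QE]]] := int_Smith_normal_form Q.
set D := \matrix_(i, j) _ in QE.
have volD : vol D = \prod_(i < n) d`_i.
  rewrite vol_diag => [|i j ij]; last by rewrite mxE (inj_eq val_inj) (negPf ij).
  by apply: eq_bigr => i _; rewrite mxE eqxx mulr1n.
have volQ : `|vol Q|%N = (\prod_(i < n) `|(d`_i)%R|)%N.
  have := norm_vol_unit Lu; have := norm_vol_unit Uu.
  rewrite QE !volM // !abszM volD => U1 L1.
  have -> : `|vol U|%N = 1%N by lia.
  have -> : `|vol L|%N = 1%N by lia.
  rewrite mul1n muln1; elim/big_ind2: _ => // x1 x2 y1 y2 <- <-; exact: abszM.
pose F g k := (f g *m invmx U) 0 k.
have FB g h k : F (g - h) k = F g k - F h k by rewrite /F fB mulmxBl !mxE.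
have F_surj y : exists g, forall k, F g k = y k.
  have [g gE] := f_surj ((\row_k y k) *m U); exists g => k.
  by rewrite /F gE mulmxK // mxE.
have PF g : P g <-> forall k, (d`_k %| F g k)%Z.
  rewrite PE; split=> [[x xE] k|dF].
    rewrite /F xE QE mulmxA mulmxK // mulmxA mxE rpred_sum // => j _.
    rewrite [D _ _]mxE; case: (j =P k :> nat) => [/val_inj->|_]; last by rewrite /= mulr0 rpred0.
    exact: dvdz_mull.
  exists ((\row_k (F g k %/ d`_k)%Z) *m invmx L).
  rewrite QE !mulmxA mulmxKV // -[LHS](mulmxKV Uu); congr (_ *m _).
  apply/rowP => k; rewrite -/(F g k) mxE (bigD1 k) //= big1 ?addr0 => [|j jk].
    by rewrite !mxE eqxx mulr1n divzK.
  by rewrite !mxE (inj_eq val_inj) (negPf jk) mulr0.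
have PB x y : P x -> P y -> P (x - y).
  by move=> /PF xP /PF yP; apply/PF => k; rewrite FB rpredB.
(* If some d_k is 0, the volume vanishes and the k-th coordinate is an invariant of the class.
   Elements with coordinates 0, ..., K then lie in K + 1 distinct classes, too many for a
   transversal of length K. *)
rewrite volQ; have [d0|] := boolP [exists k : 'I_n, d`_k == 0].
  have /existsP[k /eqP dk] := d0; rewrite (bigD1 k) //= dk mul0n.
  apply: subgroup_index_infinite => K [s [sK _ s_cov]].
  have /boolp.choice[g gE] : forall i : 'I_K.+1, exists g, F g k = (i : nat)%:Z.
    by move=> i; have [g gE] := F_surj (fun=> (i : nat)%:Z); exists g.
  have /boolp.choice[c cE] : forall i, exists j : 'I_K, P (g i - s`_j).
    move=> i; have [x /(nthP 0)[j]] := s_cov (g i).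
    by rewrite sK => jK <-; exists (Ordinal jK).
  suff /leq_card : injective c by rewrite !card_ord ltnn.
  move=> i j cij; have := cE j; rewrite -cij => cEj.
  have /PF/(_ k) := PB _ _ (cE i) cEj; rewrite opprB addrA subrK dk FB !gE.
  by rewrite dvd0z => /eqP ij; apply/val_inj => /=; lia.
rewrite negb_exists => /forallP d0.
have dgt0 (k : 'I_n) : (0 < `|(d`_k)%R|)%N by rewrite absz_gt0.
(* The successor form makes [inord] applicable; since d_k is nonzero, the k-th factor has exactly
   |d_k| elements. *)
pose T := {dffun forall k : 'I_n, 'I_(`|(d`_k)%R|%N.-1).+1}.
have -> : (\prod_(i < n) `|(d`_i)%R| = #|{: T}|)%N.
  rewrite card_dep_ffun foldrE big_map big_enum /=.
  by apply: eq_bigr => k _; rewrite card_ord prednK.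
pose c g : T := [ffun k => inord `|(F g k %% d`_k)%Z|%N].
have cE g k : (c g k)%:Z = (F g k %% d`_k)%Z.
  rewrite ffunE inordK ?prednK //; last first.
    by have := ltz_mod (F g k) (d0 k); have := modz_ge0 (F g k) (d0 k); lia.
  by rewrite gez0_abs // modz_ge0.
apply: subgroup_indexE PB _; apply: (@has_index_classes _ c) => [t|g h].
  have [g gE] := F_surj (fun k => (t k)%:Z); exists g; apply/ffunP => k.
  apply/val_inj; apply: (can_inj absz_nat); rewrite /= cE gE -modz_abs modz_small //.
  by have := ltn_ord (t k); have := dgt0 k; lia.
rewrite PF; split=> [dF|cgh k].
  apply/ffunP => k; apply/val_inj; apply: (can_inj absz_nat); rewrite /= !cE.
  by apply/eqP; rewrite eqz_mod_dvd -FB.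
by rewrite FB -eqz_mod_dvd -!cE cgh.
Qed.

End SubgroupIndex.

(** * The lattices of a rational subspace and of its annihilator *)

Section RationalLattices.
Variables (R : realType) (r : nat).
Implicit Types (D : 'M[rat]_r) (u n : 'rV[int]_r).

Lemma toRM p m q (A : 'M[int]_(p, m)) (B : 'M[int]_(m, q)) :
  toR R (A *m B) = toR R A *m toR R B.
Proof. exact: map_mxM. Qed.

Lemma toR_inj p m : injective (@toR R p m).
Proof.
move=> A B /matrixP AB; apply/matrixP => i j.
by have := AB i j; rewrite !mxE => /intr_inj.
Qed.

Lemma toR0 p m : toR R (0 : 'M[int]_(p, m)) = 0. Proof. exact: map_mx0. Qed.

Lemma toRZ p m z (A : 'M[int]_(p, m)) : toR R (z *: A) = z%:~R *: toR R A.
Proof. exact: map_mxZ. Qed.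

(** [perp_basis] requires unique coordinates, so applying it to B x calls for the injectivity of B,
    which is the uniqueness at m = 0. *)
Lemma perp_basis_ker D c (B : 'M[int]_(r, c)) (x : 'cV[int]_c) :
  perp_basis R D B -> dirspace R D *m toR R (B *m x) = 0.
Proof.
move=> pB; apply/pB; exists x; split=> // y Bxy.
have /pB[z [_ z_uniq]] : dirspace R D *m toR R (0 : 'cV_r) = 0 by rewrite toR0 mulmx0.
have z0 : z = 0 by apply: z_uniq; rewrite mulmx0.
apply/eqP; rewrite -subr_eq0 -[_ - _](z_uniq _) ?z0 //.
by rewrite mulmxBr -Bxy subrr.
Qed.

Lemma perp_basis_mul D c (B : 'M[int]_(r, c)) :
  perp_basis R D B -> dirspace R D *m toR R B = 0.
Proof.
move=> pB; apply/matrixP => i j; have := perp_basis_ker (delta_mx j 0) pB.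
by rewrite toRM /toR map_delta_mx mulmxA -colE => /colP/(_ i); rewrite !mxE.
Qed.

(** The annihilator of a subspace is saturated: it contains every vector that has a nonzero multiple
    in it. Hence the invariant factors of B are units. The left inverse makes n |-> n B surjective,
    which identifies N/L_N with Z^c. *)
Lemma perp_basis_linv D c (B : 'M[int]_(r, c)) :
  perp_basis R D B -> exists C, C *m B = 1%:M.
Proof.
move=> pB; have [L Lu [U Uu [d _ BE]]] := int_Smith_normal_form B.
set S := \matrix_(i, j) _ in BE.
have B_inj (x : 'cV[int]_c) : B *m x = 0 -> x = 0.
  have /pB[z [_ z_uniq]] : dirspace R D *m toR R (0 : 'cV_r) = 0.
    by rewrite toR0 mulmx0.
  by move=> Bx; rewrite -(z_uniq x) ?Bx // (z_uniq 0) ?mulmx0.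
have S_inj (x : 'cV[int]_c) : S *m x = 0 -> x = 0.
  move=> Sx; have /B_inj/(congr1 (mulmx U)) : B *m (invmx U *m x) = 0.
    by rewrite BE -!mulmxA mulKVmx // Sx mulmx0.
  by rewrite mulKVmx // mulmx0.
have e0 (j : 'I_c) : (delta_mx j 0 : 'cV[int]_c) != 0.
  by apply/eqP => /colP/(_ j)/eqP; rewrite !mxE !eqxx.
(* A column beyond the r-th one would be zero in the Smith form, against injectivity. *)
have j_lt (j : 'I_c) : (j < r)%N.
  rewrite ltnNge; apply: contra (e0 j) => rj; apply/eqP/S_inj/colP => i.
  rewrite -colE !mxE; case: eqP => // ij.
  by have := ltn_ord i; rewrite ij ltnNge rj.
have SE (j : 'I_c) : S *m delta_mx j 0 =
    d`_j *: (delta_mx (Ordinal (j_lt j)) 0 : 'cV[int]_r).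
  apply/colP => i; rewrite -colE !mxE eqxx andbT -val_eqE /= mulr_natr.
  by case: eqP => [->|].
have d_unit (j : 'I_c) : d`_j * d`_j = 1.
  have dj : d`_j != 0.
    by apply: contra (e0 j) => /eqP dj; apply/eqP/S_inj; rewrite SE dj scale0r.
  (* The vector d_j y is in the span of B, so it vanishes on the subspace, and so does y. Thus y = B
     x, and comparing j-th coordinates shows that d_j divides 1. *)
  pose y : 'cV[int]_r := L *m delta_mx (Ordinal (j_lt j)) 0.
  have /pB[x [yE _]] : dirspace R D *m toR R y = 0.
    have := perp_basis_ker (invmx U *m delta_mx j 0) pB.
    rewrite BE -!mulmxA mulKVmx // SE -scalemxAr toRZ -scalemxAr.
    by move=> /eqP; rewrite scaler_eq0 intr_eq0 (negPf dj) => /eqP.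
  have : (delta_mx (Ordinal (j_lt j)) 0 : 'cV[int]_r) = S *m (U *m x).
    by rewrite -[LHS](mulKmx Lu) -/y yE BE -!mulmxA mulKmx.
  move=> /colP/(_ (Ordinal (j_lt j))); rewrite mxE !eqxx mxE.
  rewrite (bigD1 j) //= big1 ?addr0 => [|k kj].
    rewrite mxE /= eqxx mulr1n => /(congr1 absz) /esym/eqP.
    rewrite abszM muln_eq1 => /andP[/eqP]; move: (d`_j) => z; nia.
  by rewrite mxE /= eq_sym (inj_eq val_inj) (negPf kj) mul0r.
exists (invmx U *m S^T *m invmx L); rewrite BE -!mulmxA mulKmx //.
rewrite [S^T *m _]mulmxA; suff -> : S^T *m S = 1%:M by rewrite mul1mx mulVmx.
apply/matrixP => i j; rewrite !mxE (bigD1 (Ordinal (j_lt j))) //= big1 ?addr0 => [|k kj].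
  rewrite !mxE /= eqxx mulr1n; case: (eqVneq i j) => [->|ij]; first by rewrite eqxx; exact: d_unit.
  by rewrite eq_sym (inj_eq val_inj) (negPf ij) mul0r.
by rewrite [S k j]mxE; case: (k =P j :> nat) kj => [kj /eqP[]|]; [exact/val_inj | rewrite mulr0].
Qed.

Lemma rat_common_denom (s : seq rat) :
  exists2 z : int, z != 0 & forall x, x \in s -> exists y : int, z%:~R * x = y%:~R.
Proof.
elim: s => [|x s [z z0 zP]]; first by exists 1.
exists (denq x * z); first by rewrite mulf_neq0 // denq_neq0.
move=> y; rewrite inE => /orP[/eqP->|/zP[t tE]].
  exists (numq x * z); rewrite !rmorphM /= mulrAC; congr (_ * _).
  by rewrite mulrC -numqE.
by exists (denq x * t); rewrite !rmorphM /= -tE mulrA.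
Qed.

Lemma rat_matrix_denom p m (K : 'M[rat]_(p, m)) :
  exists2 z : int, z != 0 & exists A : 'M[int]_(p, m), z%:~R *: K = map_mx intr A.
Proof.
have [z z0 zP] := rat_common_denom [seq K ij.1 ij.2 | ij : 'I_p * 'I_m].
exists z => //; have /boolp.choice[A AE] : forall ij : 'I_p * 'I_m, exists y : int,
    z%:~R * K ij.1 ij.2 = y%:~R.
  by move=> ij; apply: zP; apply: codom_f (fun ij => K ij.1 ij.2) ij.
by exists (\matrix_(i, j) A (i, j)); apply/matrixP => i j; rewrite !mxE -AE.
Qed.

(** The columns of [cokermx D] annihilate D over the rationals; after clearing denominators they are
    integral, hence combinations of the columns of B. *)
Lemma perp_basis_coker D c (B : 'M[int]_(r, c)) : perp_basis R D B ->
  exists2 z : int, z != 0 & exists X, z%:~R *: cokermx D = map_mx intr (B *m X).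
Proof.
move=> pB; have [z z0 [A AE]] := rat_matrix_denom (cokermx D).
exists z => //; have /boolp.choice[X XE] : forall j, exists x, col j A = B *m x.
  move=> j; have /pB[x [? _]] : dirspace R D *m toR R (col j A) = 0; last by exists x.
  have -> : toR R (col j A) = map_mx ratr (map_mx intr (col j A)).
    by apply/matrixP => k l; rewrite !mxE ratr_int.
  rewrite -map_mxM map_col -AE colE -scalemxAl -scalemxAr mulmxA mulmx_coker.
  by rewrite mul0mx scaler0 map_mx0.
exists (\matrix_(i, j) X j i 0); rewrite AE; congr map_mx.
apply/matrixP => i j; have /colP/(_ i) := XE j; rewrite !mxE => ->.
by apply: eq_bigr => k _; rewrite mxE.
Qed.

(** The subspace is cut out by [cokermx D], whose columns are rational combinations of those of
    B. *)
Lemma in_LN_perp_basis D c (B : 'M[int]_(r, c)) n :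
  perp_basis R D B -> in_LN (dirspace R D) n <-> n *m B = 0.
Proof.
move=> pB; rewrite /in_LN; split=> [/submxP[x xE]|nB].
  by apply: toR_inj; rewrite toRM xE toR0 -mulmxA perp_basis_mul // mulmx0.
have [z z0 [X XE]] := perp_basis_coker pB.
have z0R : z%:~R != 0 :> R by rewrite intr_eq0.
rewrite submxE -map_cokermx -(inj_eq (scalerI z0R)) scaler0 scalemxAr.
have -> : z%:~R *: map_mx ratr (cokermx D) = toR R (B *m X).
  have -> : toR R (B *m X) = map_mx ratr (map_mx intr (B *m X)).
    by apply/matrixP => k l; rewrite !mxE ratr_int.
  by rewrite -XE map_mxZ /= ratr_int.
by rewrite -toRM mulmxA nB mul0mx toR0.
Qed.

(** B has rank c by its left inverse, and its columns span the same rational space as those of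
    [cokermx D]: one inequality of ranks for each inclusion. *)
Lemma codim_perp_basis D c (B : 'M[int]_(r, c)) : perp_basis R D B -> codim R D = c.
Proof.
move=> pB; have [C CB] := perp_basis_linv pB.
have [z z0 [X XE]] := perp_basis_coker pB.
have rankB : \rank (map_mx intr B : 'M[rat]_(r, c)) = c.
  apply/eqP; rewrite -/(row_full _); apply/row_fullP; exists (map_mx intr C).
  by rewrite -map_mxM CB map_mx1.
rewrite /codim /dirspace mxrank_map; apply/eqP; rewrite eqn_leq; apply/andP; split.
  rewrite -mxrank_coker -[X in (_ <= X)%N]rankB.
  rewrite -(mxrank_scale_nz (cokermx D) (a := z%:~R)) ?intr_eq0 // XE map_mxM.
  exact: mxrankM_maxl.
have DB : D *m map_mx intr B = 0.
  apply: (@map_mx_inj _ _ (ratr : rat -> R)); rewrite map_mxM map_mx0.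
  rewrite -[RHS](perp_basis_mul pB); congr (_ *m _).
  by apply/matrixP => i j; rewrite !mxE /= ratr_int.
have := mulmx0_rank_max DB; rewrite rankB; have := rank_leq_row D; lia.
Qed.
(** The Smith form of a single row writes u as k times the first row of a unimodular matrix, and
    primitivity forces k to be 1 or -1. *)
Lemma primitive_bezout u : primitive u -> exists b : 'cV[int]_r, u *m b = 1%:M.
Proof.
move=> u_prim; have [L _ [U Uu [d _ uE]]] := int_Smith_normal_form u.
set S := \matrix_(i, j) _ in uE.
(* In rank 0 the only vector is [0 *+ 0], which is not primitive. *)
have [r0|r_gt0] := posnP r.
  suff /u_prim : u = 0 *+ 0 by []; apply/rowP => j.
  by have := ltn_ord j; rewrite {2}r0.
pose j0 := Ordinal r_gt0; pose k := L 0 0 * d`_0.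
have LS : L *m S = k *: delta_mx 0 j0.
  apply/rowP => j; rewrite !mxE big_ord1 [S _ _]mxE eqxx.
  case: (eqVneq j j0) => [->|]; first by rewrite mulr1.
  by rewrite -val_eqE eq_sym => /negPf /= ->; rewrite !mulr0.
have uk : u = k *: row j0 U by rewrite uE LS -scalemxAl rowE.
have k1 : `|k|%N = 1%N.
  case: (intP k) uk => [|n|n] uk.
  - by apply: (u_prim _ 0); rewrite uk scale0r mul0rn.
  - by apply: (u_prim _ (row j0 U)); rewrite {1}uk -scaler_nat natz.
  apply: (u_prim _ (- row j0 U)); rewrite {1}uk abszN absz_nat.
  by rewrite mulNrn scaleNr -scaler_nat natz.
exists (invmx U *m (k *: delta_mx j0 0)).
rewrite uk rowE -scalemxAl mulmxA mulmxK // -scalemxAr scalerA mul_delta_mx.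
have -> : k * k = 1 by nia.
by rewrite scale1r; apply/matrixP => i j; rewrite !ord1 !mxE !eqxx.
Qed.

(** If an integral vector is x u with x real, pairing it with a covector of value 1 on u shows that
    x is an integer. The case u = 0 serves the contracted edges. *)
Lemma in_LN_line u n (t : R) : t != 0 -> u = 0 \/ primitive u ->
  in_LN (t *: toR R u) n <-> exists z, n = z *: u.
Proof.
move=> t0 u_prim; rewrite /in_LN; split=> [|[z ->]]; last first.
  by rewrite toRZ (eqmx_scale _ t0) scalemx_sub.
case/sub_rVP => x; rewrite scalerA; move: (x * t) => {}x nE.
case: u_prim => [u0|/primitive_bezout[b ub]].
  by exists 0; apply: toR_inj; rewrite nE u0 scaler0 toR0 scaler0.
have xE : x = ((n *m b) 0 0)%:~R.
  have /matrixP/(_ 0 0) : toR R (n *m b) = x *: toR R (u *m b).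
    by rewrite !toRM nE -scalemxAl.
  by rewrite ub !mxE eqxx mulr1.
by exists ((n *m b) 0 0); apply: toR_inj; rewrite nE toRZ -xE.
Qed.

End RationalLattices.
(** * Rooted trees *)

Section RootedTree.
Variables (I : finType) (G : mgraph I) (Vinf : vert G).

(** The depth is the graph distance to Vinf: [ball k] collects the vertices at distance at most k,
    and a vertex first reached in ball k + 1 has a neighbour in ball k. *)
Lemma spanning_depth : (forall x y : vert G, connect (@adjacent I G) x y) ->
  exists d : vert G -> nat, forall v, v != Vinf ->
    exists e y, joins e v y /\ (d y < d v)%N.
Proof.
move=> conn.
pose ball k := iter k (fun A : {set vert G} => A :|: [set x | [exists y in A, adjacent x y]])
  [set Vinf].
have ball_ex v : exists k, v \in ball k.
  have /connectP[p] := conn v Vinf; elim: p v => [|y p IHp] v /=.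
    by move=> _ <-; exists 0%N; rewrite inE.
  move=> /andP[vy /IHp H] /H[k yk]; exists k.+1; rewrite inE; apply/orP; right.
  by rewrite inE; apply/existsP; exists y; rewrite yk.
exists (fun v => ex_minn (ball_ex v)) => v vinf.
case: ex_minnP => -[|k]; first by rewrite inE (negPf vinf).
rewrite inE => /orP[vk /(_ k vk)|]; first by rewrite ltnn.
rewrite inE => /existsP[y /andP[yk /existsP[e vy]]] _; exists e, y; split=> //.
by case: ex_minnP => m _ /(_ k yk).
Qed.

(* Each vertex [v != Vinf] chooses an edge towards a vertex of smaller depth. The
   choice is injective, hence bijective by counting, and [c] is its inverse. *)
Lemma rooted_tree : (forall x y : vert G, connect (@adjacent I G) x y) ->
    #|vert G| = #|cedge G|.+1 ->
  exists (c q : cedge G -> vert G) (d : vert G -> nat),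
    [/\ forall e, joins e (c e) (q e), forall e, (d (q e) < d (c e))%N,
        injective c, forall e, c e != Vinf & forall v, v != Vinf -> exists e, c e = v].
Proof.
move=> /spanning_depth[d dP] cardV.
have /boolp.choice[par parP] : forall x : {x : vert G | x != Vinf},
    exists e, exists y, joins e (val x) y /\ (d y < d (val x))%N.
  by case=> v vinf; apply: dP.
(* Two distinct vertices choosing the same edge would be its two endpoints, each deeper than the
   other. *)
have par_inj : injective par.
  move=> x y xy; have [x' [jx dx]] := parP x; have [y' [jy dy]] := parP y.
  apply: val_inj; rewrite xy in jx; move: jx jy; rewrite /joins.
  case/orP=> /andP[/eqP E1 /eqP E2] /orP[] /andP[/eqP E3 /eqP E4].
  - by rewrite -E1 E3.
  - by move: dx dy; rewrite -E1 -E2 -E3 -E4 => H1 H2; have := ltn_trans H1 H2; rewrite ltnn.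
  - by move: dx dy; rewrite -E1 -E2 -E3 -E4 => H1 H2; have := ltn_trans H1 H2; rewrite ltnn.
  by rewrite -E2 E4.
have [c' parK c'K] : bijective par.
  apply: inj_card_bij par_inj _; rewrite card_sig.
  have := cardC1 Vinf; rewrite cardV /= => <-.
  by apply: eq_leq; apply: eq_card => x; rewrite !inE.
have /boolp.choice[q qP] : forall e, exists y, joins e (val (c' e)) y /\ (d y < d (val (c' e)))%N.
  by move=> e; have [y yP] := parP (c' e); exists y; rewrite c'K in yP.
exists (fun e => val (c' e)), q, d; split=> [e|e|e e'|e|v vinf].
- by have [] := qP e.
- by have [] := qP e.
- by move=> /val_inj /(can_inj c'K).
- exact: valP (c' e).
by exists (par (exist _ v vinf)); rewrite parK.
Qed.

Variables (c q : cedge G -> vert G) (d : vert G -> nat).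
Hypotheses (cqP : forall e, joins e (c e) (q e)) (dP : forall e, (d (q e) < d (c e))%N).
Hypotheses (c_inj : injective c) (c_inf : forall e, c e != Vinf).
Hypothesis c_surj : forall v, v != Vinf -> exists e, c e = v.

Definition parent_rel : rel (vert G) := [rel x y | [exists e, (c e == x) && (q e == y)]].

(* [e] lies on the path from [v] to [Vinf] *)
Definition anc v e := connect parent_rel v (c e).

Lemma connect_parent e x :
  connect parent_rel (c e) x = (x == c e) || connect parent_rel (q e) x.
Proof.
apply/connectP/orP => [[[|y p]] /=|[/eqP->|/connectP[p pP xE]]].
- by move=> _ ->; left.
- move=> /andP[/existsP[e' /andP[/eqP/c_inj-> /eqP<-]] yp] xE; right.
  by apply/connectP; exists p.
- by exists [::].
exists (q e :: p) => //=; rewrite pP andbT.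
by apply/existsP; exists e; rewrite !eqxx.
Qed.

Lemma anc_child e e' : anc (c e) e' = (e' == e) || anc (q e) e'.
Proof. by rewrite /anc connect_parent (inj_eq c_inj). Qed.

Lemma anc_root e : anc Vinf e = false.
Proof.
apply/negbTE/negP => /connectP[[|y p] /=].
  by move=> _ /eqP; rewrite (negPf (c_inf e)).
by move=> /andP[/existsP[e' /andP[ce']]]; rewrite (negPf (c_inf e')) in ce'.
Qed.

Lemma tree_ind (Q : vert G -> Prop) :
  Q Vinf -> (forall e, Q (q e) -> Q (c e)) -> forall v, Q v.
Proof.
move=> Q0 QS v; have [m] := ubnP (d v); elim: m => // m IHm in v *; rewrite ltnS => dv.
have [->//|/c_surj[e ce]] := eqVneq v Vinf.
by rewrite -ce; apply/QS/IHm; apply: leq_trans (dP e) _; rewrite ce.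
Qed.

Lemma anc_depth v e : anc v e -> (d (c e) <= d v)%N.
Proof.
move: v; apply: tree_ind => [|e' IH]; first by rewrite anc_root.
by rewrite anc_child => /orP[/eqP->//|/IH/leq_trans]; apply; apply/ltnW/dP.
Qed.

Lemma anc_parent e : anc (q e) e = false.
Proof. by apply/negP => /anc_depth; rewrite leqNgt dP. Qed.

Lemma sum_anc_child (M : zmodType) (h : cedge G -> M) e :
  \sum_(e' | anc (c e) e') h e' = h e + \sum_(e' | anc (q e) e') h e'.
Proof.
rewrite (bigD1 e) /=; last by rewrite anc_child eqxx.
congr (_ + _); apply: eq_bigl => e'; rewrite anc_child.
by case: eqVneq => [->|_]; [rewrite anc_parent | rewrite andbT].
Qed.

Lemma sum_anc_root (M : zmodType) (h : cedge G -> M) : \sum_(e | anc Vinf e) h e = 0.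
Proof. by rewrite big_pred0 // => e; apply: anc_root. Qed.

(** Telescoping along the path to Vinf. *)
Lemma path_sum (M : zmodType) (f : vert G -> M) (h : cedge G -> M) :
  (forall e, f (c e) - f (q e) = h e) -> forall v, f v = f Vinf + \sum_(e | anc v e) h e.
Proof.
move=> fh; apply: tree_ind => [|e IH]; first by rewrite sum_anc_root addr0.
by rewrite sum_anc_child addrCA -IH -fh subrK.
Qed.

Lemma ends_cq e v : (src e == v) || (tgt e == v) = (v == c e) || (v == q e).
Proof.
have /orP[] := cqP e => /andP[/eqP<- /eqP<-]; rewrite ![v == _]eq_sym //.
by rewrite orbC.
Qed.

(** The path of parents from [q e] stays at depths below that of [c e], so it never starts an edge
    at [c e]. *)
Lemma connect_without_parent e : connect (adjacent_without e) (q e) Vinf.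
Proof.
have [m] := ubnP (d (q e)).
have : (d (q e) < d (c e))%N by [].
move: (q e) => v; elim: m => // m IHm in v *; rewrite ltnS => dv dm.
have [->//|/c_surj[e' ce']] := eqVneq v Vinf; rewrite -ce'.
have dq := dP e'; rewrite ce' in dq.
apply: connect_trans (connect1 _) (IHm (q e') _ _); last exact: leq_trans dq dm.
  apply/existsP; exists e'; rewrite cqP andbT.
  by apply: contraTneq dv => <-; rewrite ce' ltnn.
exact: ltn_trans dq dv.
Qed.

(** The vertices whose path to Vinf uses e are closed under adjacency once e is removed; they
    include [c e] but not Vinf. *)
Lemma not_connect_without_child e : connect (adjacent_without e) (c e) Vinf = false.
Proof.
pose A := [pred x | anc x e].
have clA : fingraph.closed (adjacent_without e) A.
  move=> x y /existsP[e' /andP[ee' xy]]; rewrite !inE.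
  have E : anc (c e') e = anc (q e') e by rewrite anc_child eq_sym (negPf ee').
  have := cqP e'; rewrite /joins in xy *.
  by case/orP: xy => /andP[/eqP<- /eqP<-] /orP[] /andP[/eqP E1 /eqP E2];
    rewrite E1 E2.
apply/negP => /(closed_connect clA); rewrite !inE anc_root anc_child eqxx.
by [].
Qed.

Lemma flows_outE v e : flows_out Vinf v e = (v == c e).
Proof.
rewrite /flows_out ends_cq; case: eqVneq => [->|_] /=.
  by rewrite not_connect_without_child.
by case: eqVneq => [->|_] //=; rewrite connect_without_parent.
Qed.

(** The vertex into which E flows. *)
Definition parent_end (E : cedge G + I) : vert G :=
  match E with inl e => q e | inr i => Defs.root G i end.

Lemma flows_intoE v E : flows_into Vinf v E = (parent_end E == v).
Proof.
case: E => [e|i] //=; rewrite ends_cq [q e == v]eq_sym.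
have cq : c e != q e by apply: contraTneq (dP e) => ->; rewrite ltnn.
case: eqVneq => [->|_] /=; first by rewrite not_connect_without_child (negPf cq).
by case: eqVneq => [->|_] //=; rewrite connect_without_parent.
Qed.

Lemma incident_root E : incident Vinf E = (parent_end E == Vinf).
Proof.
case: E => [e|i] //=; rewrite ends_cq [q e == _]eq_sym.
by rewrite eq_sym (negPf (c_inf e)).
Qed.

End RootedTree.

(** * The dimension count for trees *)

Section GenusZero.
Variables (I : finType) (G : mgraph I).
Hypotheses (genus0 : no_higher_genus_vertex G) (curve_genus0 : curve_genus G = 0).

Lemma card_vert_tree : #|vert G| = #|cedge G|.+1.
Proof.
move: curve_genus0; rewrite /curve_genus big1 => [|v _]; last by rewrite genus0.
lia.
Qed.

Lemma sum_fibers (S : finType) (f : S -> vert G) :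
  (\sum_v #|[set x | f x == v]| = #|S|)%N.
Proof.
rewrite -[RHS]cardsT -[RHS]sum1_card (partition_big f xpredT) //=.
by apply: eq_bigr => v _; rewrite -sum1_card; apply: eq_bigl => x; rewrite !inE.
Qed.

(** The valences sum to 2 #E + #I and #V = #E + 1. The result is the number of parameters of a curve
    of this type: the position of Vinf and the edge lengths. *)
Lemma dtrop_tree r : dtrop G r = (r + #|cedge G|)%N.
Proof.
rewrite /dtrop curve_genus0.
have -> : \sum_(v : vert G) ov v = (\sum_(v : vert G) valence v)%N%:Z - 3 * #|vert G|%:Z.
  rewrite (big_morph Posz PoszD erefl).
  transitivity (\sum_(v : vert G) ((valence v)%:Z - 3)).
    by apply: eq_bigr => v _; rewrite /ov genus0 mulr0 addr0.
  by rewrite sumrB sumr_const -[3 *+ _]mulr_natr !natz.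
have -> : (\sum_(v : vert G) valence v = 2 * #|cedge G| + #|I|)%N.
  rewrite /valence big_split /= sum_fibers /cvalence big_split /=; congr addn.
  rewrite mul2n -addnn; congr addn.
    rewrite -[RHS](sum_fibers (@src I G)).
    by apply: eq_bigr => v _; apply: eq_card => e; rewrite !inE.
  rewrite -[RHS](sum_fibers (@tgt I G)).
  by apply: eq_bigr => v _; apply: eq_card => e; rewrite !inE.
rewrite card_vert_tree; lia.
Qed.

End GenusZero.
(** * Contracting the edges of the tree *)

Section Contractions.

(** The perturbation adds to each pulled back covector a multiple of x, and x wedge x = 0 stops the
    expansion after the first order. *)
Lemma pullback_rank1 n r (P : 'M[int]_(n, r)) (x : 'cV[int]_n) (y : 'rV[int]_r) a :
  pullback (P + x *m y) a =
  pullback P a + wedge (ext_covector x) (pullback P (contract y a)).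
Proof.
elim/ext_ind: a => [|a b IHa IHb|a z IHa|m a IHa].
- by rewrite !pullback1 contract1 raddf0 wedgex0 addr0.
- by rewrite !raddfD /= IHa IHb addrACA.
- by rewrite !raddfMz /= IHa mulrzDl.
have covE : ext_covector ((P + x *m y) *m m) =
    ext_covector (P *m m) + ext_covector x *~ (y *m m) 0 0 :> ext n.
  rewrite mulmxDl -mulmxA raddfD /= -covectorZ; congr (_ + ext_covector _).
  by rewrite [y *m m]mx11_scalar mul_mx_scalar !mxE.
rewrite pullback_covector IHa covE wedgeDx !raddfD /= !wedgeMz covectorK mul0rz addr0.
rewrite contract_covector pullback_covector -!addrA; congr (_ + _).
rewrite raddfB /= raddfMz /= pullback_covector raddfB /= raddfMz /=.
by rewrite [X in X + _]covectorC addrC.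
Qed.

(** A form already contracted with y does not see displacements along y. With [path_mx_child] this
    moves a bracket from the child end of an edge to its parent end. *)
Lemma pullback_contract_rank1 n r (P : 'M[int]_(n, r)) (x : 'cV[int]_n) y a :
  pullback (P + x *m y) (contract y a) = pullback P (contract y a).
Proof. by rewrite pullback_rank1 contractK raddf0 wedgex0 addr0. Qed.

Lemma contract_delta r (j : 'I_r) (a : ext r) (S : {set 'I_r}) :
  j \notin S -> eq_up_to_sign (contract (delta_mx 0 j) a S) (a (j |: S)).
Proof.
move=> jS; rewrite ffunE (bigD1 j) //= big1 ?addr0 => [|k /andP[_ kj]]; last first.
  by rewrite mxE (negPf kj) andbF mulr0 mul0r.
rewrite mxE !eqxx mulr1 -signr_odd; case: (odd _); rewrite ?mul1r ?mulN1r.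
  exact: eqs_opp.
exact: eqs_refl.
Qed.

(** Each contraction with a basis vector e_j reads, up to sign, the coefficient whose index set is
    enlarged by j. *)
Lemma contract_deltas r (l : seq 'I_r) (a : ext r) (S : {set 'I_r}) :
    uniq l -> (forall j, j \in l -> j \notin S) ->
  eq_up_to_sign (foldr (fun j => contract (delta_mx 0 j)) a l S) (a ([set j in l] :|: S)).
Proof.
elim: l S => [|j l IHl] S /=.
  by move=> _ _; have -> : [set j in [::]] :|: S = S; [apply/setP=> j; rewrite !inE | left].
move=> /andP[jl l_uniq] lS; apply: eqs_trans (contract_delta _ (lS j (mem_head _ _))) _.
have -> : [set j0 in j :: l] :|: S = [set k in l] :|: (j |: S).
  by apply/setP => k; rewrite !inE; case: (k == j); case: (k \in l).
apply: IHl => // k kl; rewrite !inE negb_or lS ?inE ?kl ?orbT // andbT.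
by apply: contraNneq jl => <-.
Qed.

Lemma contracts_raddf (n : nat) (J : Type) (f : J -> 'rV[int]_n) (l : seq J) a b :
  eq_up_to_sign a b ->
  eq_up_to_sign (foldr (fun j => contract (f j)) a l) (foldr (fun j => contract (f j)) b l).
Proof. by move=> ab; elim: l => //= j l; apply: eqs_raddf. Qed.

Lemma homogeneous_contracts (n : nat) (J : Type) (f : J -> 'rV[int]_n) (l : seq J) p a :
  homogeneous p a -> homogeneous (p - size l) (foldr (fun j => contract (f j)) a l).
Proof.
move=> ha; elim: l => [|j l IHl] /=; first by rewrite subn0.
by rewrite subnS; apply: homogeneous_contract.
Qed.

End Contractions.

Section Frontier.
Variables (I : finType) (G : mgraph I) (Vinf : vert G).
Variables (c q : cedge G -> vert G) (d : vert G -> nat).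
Hypotheses (dP : forall e, (d (q e) < d (c e))%N).
Hypotheses (c_inj : injective c) (c_inf : forall e, c e != Vinf).
Hypothesis c_surj : forall v, v != Vinf -> exists e, c e = v.
Variable r : nat.
Local Notation n := (r + #|cedge G|)%N.
Local Notation pe := (parent_end q).

(* The position of the vertex [v] as a linear function of the position of [Vinf]
   and of the lengths of the edges, [u e] being the direction of [e]. *)
Definition path_mx (u : cedge G -> 'rV[int]_r) (v : vert G) : 'M[int]_(n, r) :=
  col_mx 1%:M (\matrix_(k, j) if anc c q v (enum_val k) then u (enum_val k) 0 j else 0).

Definition edge_vec (e : cedge G) : 'rV[int]_n := delta_mx 0 (rshift r (enum_rank e)).

Lemma edge_vec_path u v e : edge_vec e *m path_mx u v = if anc c q v e then u e else 0.
Proof.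
apply/rowP => j; rewrite -rowE mxE /path_mx col_mxEd mxE enum_rankK.
by case: ifP => //; rewrite mxE.
Qed.

Lemma path_mx_child u e : path_mx u (c e) = path_mx u (q e) + (edge_vec e)^T *m u e.
Proof.
apply/matrixP => k j; rewrite [RHS]mxE [X in _ = _ + X]mxE big_ord1 /path_mx.
case: (split_ordP k) => k' ->.
  by rewrite !col_mxEu !mxE eq_lrshift andbF mul0r addr0.
rewrite !col_mxEd !mxE (inj_eq (@rshift_inj _ _)) (anc_child q c_inj) eqxx /=.
rewrite -[k' == _](inj_eq enum_val_inj) enum_rankK; case: eqVneq => [->|_] /=.
  by rewrite (anc_parent dP c_inj c_inf c_surj) add0r mul1r.
by rewrite mul0r addr0.
Qed.

Variables (u : cedge G -> 'rV[int]_r) (alpha : cedge G + I -> ext r).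
Hypothesis alpha_homog : forall E, exists p, homogeneous p (alpha E).
Hypothesis alpha_flow : forall e, exists2 s, perm_eq s (enum [pred E | pe E == c e]) &
  eq_up_to_sign (alpha (inl e)) (contract (u e) (\big[@wedge r/ext_one r]_(E <- s) alpha E)).

(** Placing the form at the end towards which E flows gives all edges flowing into a vertex the same
    matrix, so that their product is a single pullback. *)
Definition pulled E : ext n := pullback (path_mx u (pe E)) (alpha E).

Lemma pulled_homog E : exists p, homogeneous p (pulled E).
Proof. by have [p pE] := alpha_homog E; exists p; apply: homogeneous_pullback. Qed.

(* If [l] lists the compact edges whose element has been computed, these are the
   edges whose element is known but not yet used to compute another one. *)
Definition frontier (l : seq (cedge G)) : pred (cedge G + I) :=
  [pred E | (if E is inl e then e \in l else true) && ~~ has (fun e => c e == pe E) l].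

(* The compact edges are processed from the deepest one up to the root. When [e] is
   processed, all the frontier factors but those of the edges flowing into [c e] are
   independent of the length of [e]; contracting the product of the latter along
   [edge_vec e] is the bracket of rule (ii). *)
Lemma frontier_contract l1 l2 : uniq (l1 ++ l2) -> (forall e, e \in l1 ++ l2) ->
    sorted (relpre (d \o c) leq) (l1 ++ l2) ->
  exists2 s, perm_eq s (enum (frontier l2)) &
    eq_up_to_sign (foldr (fun e => contract (edge_vec e))
                     (\big[@wedge n/ext_one n]_i pulled (inr i)) l2)
                  (\big[@wedge n/ext_one n]_(E <- s) pulled E).
Proof.
elim: l2 l1 => [|e l2 IHl] l1 l_uniq l_all l_sorted.
  exists (map inr (index_enum I)); last by rewrite big_map; left.
  apply: uniq_perm; rewrite ?enum_uniq ?map_inj_uniq ?index_enum_uniq //; first by move=> i j [].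
  move=> [e|i]; rewrite mem_enum inE /= ?andbT; last by apply/map_f/mem_index_enum.
  by apply/negbTE/mapP => -[].
have [||| s sP sE] := IHl (rcons l1 e).
- by rewrite cat_rcons.
- by move=> e'; rewrite cat_rcons.
- by rewrite cat_rcons.
have le_l2 e' : e' \in l2 -> (d (c e) <= d (c e'))%N.
  move=> e'l2; move: l_sorted; rewrite sorted_pairwise; last first.
    by move=> x y z; apply: leq_trans.
  by rewrite pairwise_cat pairwise_cons => /and3P[_ _ /andP[/allP/(_ e' e'l2)]].
(* The order is by increasing depth and the list is consumed from its end, so every edge deeper than
   e is already processed. *)
have gt_l2 e' : (d (c e) < d (c e'))%N -> e' \in l2.
  move=> ee'; have := l_all e'; rewrite mem_cat inE => /or3P[e'l1|/eqP e'e|//].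
  - move: l_sorted; rewrite sorted_pairwise; last first.
      by move=> x y z; apply: leq_trans.
    rewrite pairwise_cat => /and3P[/allrelP/(_ e' e e'l1 (mem_head _ _)) /= H _ _].
    by rewrite ltnNge H in ee'.
  by rewrite e'e ltnn in ee'.
have el2 : e \notin l2.
  by move: l_uniq; rewrite cat_uniq /= => /and4P[].
have [se seP seE] := alpha_flow e.
pose s2 := [seq E <- s | pe E != c e].
have memF E : (E \in s) = frontier l2 E by rewrite (perm_mem sP) mem_enum.
have s_uniq : uniq s by rewrite (perm_uniq sP) enum_uniq.
have memse E : (E \in se) = (pe E == c e) by rewrite (perm_mem seP) mem_enum.
have se_s E : pe E = c e -> E \in s.
  move=> peE; rewrite memF /frontier inE /= peE; apply/andP; split.
    by case: E peE => // e' /= qe'; apply: gt_l2; rewrite -qe'.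
  by apply/hasPn => e' e'l2; rewrite (inj_eq c_inj); apply: contraNneq el2 => <-.
have s_perm : perm_eq s (se ++ s2).
  rewrite -(perm_filterC (fun E => pe E == c e) s) perm_cat2r.
  apply: uniq_perm; rewrite ?filter_uniq ?(perm_uniq seP) ?enum_uniq // => E.
  rewrite memse mem_filter; case: eqP => //= peE; exact: se_s.
(* If the path from [pe E] used e, then [pe E] would be the child end of an edge strictly deeper
   than e. That edge is processed already, so E would have left the frontier. *)
have s2_anc E : E \in s2 -> anc c q (pe E) e = false.
  rewrite mem_filter memF => /andP[peE /andP[_ /hasPn nl2]].
  apply/negP => ancE; have [pinf|] := eqVneq (pe E) Vinf.
    by rewrite pinf (anc_root q c_inf) in ancE.
  move=> /c_surj[e' ce']; move: ancE; rewrite -ce' (anc_child q c_inj) => /orP[/eqP e'e|].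
    by rewrite -ce' e'e eqxx in peE.
  move=> /(anc_depth dP c_inj c_inf c_surj) dqe'.
  by have /nl2 := gt_l2 e' (leq_ltn_trans dqe' (dP e')); rewrite ce' eqxx.
have s2_contract : contract (edge_vec e) (\big[@wedge n/ext_one n]_(E <- s2) pulled E) = 0.
  elim: s2 s2_anc {s_perm} => [|E s2 IHs2] s2_anc; first by rewrite big_nil contract1.
  rewrite big_cons contract_wedgel ?IHs2 //; last first.
    by move=> E' E's2; apply: s2_anc; rewrite inE E's2 orbT.
  rewrite /pulled contract_pullback edge_vec_path s2_anc ?mem_head //.
  by rewrite contract0l raddf0 wedge0x.
exists (inl e :: s2).
  apply: uniq_perm; rewrite ?enum_uniq //=.
    rewrite filter_uniq // andbT mem_filter memF /frontier /= (negPf el2) /=.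
    by rewrite andbF.
  move=> E; rewrite mem_enum !inE mem_filter memF /frontier /= [c e == _]eq_sym negb_or.
  case: E => [e'|i] //=; rewrite inE -[inl e' == inl e]/(e' == e).
  case: (eqVneq e' e) => [->|_] /=; last exact: andbCA.
  apply/esym/andP; split; first by apply: contraTneq (dP e) => ->; rewrite ltnn.
  by apply/hasPn => e'' /le_l2; apply: contraTneq => ->; rewrite -ltnNge.
rewrite /= big_cons.
apply: eqs_trans (eqs_raddf _ sE) _ => /=.
apply: eqs_trans (eqs_raddf _ (bigwedge_perm pulled_homog s_perm)) _ => /=.
rewrite big_cat contract_wedgel //; apply: eqs_wedge (eqs_refl _).
have -> : \big[@wedge n/ext_one n]_(E <- se) pulled E =
    pullback (path_mx u (c e)) (\big[@wedge r/ext_one r]_(E <- se) alpha E).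
  rewrite pullback_bigwedge big_seq [RHS]big_seq; apply: eq_bigr => E.
  by rewrite memse /pulled => /eqP->.
(* The contraction becomes iota_{u_e} inside the pullback at [c e]; its result is insensitive to the
   rank one difference with the matrix at [q e]. *)
rewrite contract_pullback edge_vec_path (anc_child q c_inj) eqxx /= path_mx_child.
rewrite pullback_contract_rank1; apply: (eqs_raddf (pullback _)); exact: eqs_sym.
Qed.

Variables (s : seq (cedge G + I)).
Hypothesis s_root : perm_eq s (enum [pred E | pe E == Vinf]).

Lemma root_wedge : exists2 l, perm_eq l (enum (cedge G)) &
  eq_up_to_sign (foldr (fun e => contract (edge_vec e))
                     (\big[@wedge n/ext_one n]_i pulled (inr i)) l)
   (pullback (path_mx u Vinf) (\big[@wedge r/ext_one r]_(E <- s) alpha E)).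
Proof.
pose l := sort (relpre (d \o c) leq) (enum (cedge G)).
have lP : perm_eq l (enum (cedge G)) by rewrite perm_sort.
have [||| s' s'P s'E] := @frontier_contract [::] l.
- by rewrite (perm_uniq lP) enum_uniq.
- by move=> e; rewrite (perm_mem lP) mem_enum.
- by apply: sort_sorted => x y; apply: leq_total.
exists l => //; apply: eqs_trans s'E _.
have s's : perm_eq s' s.
  rewrite (perm_trans s'P) // perm_sym (perm_trans s_root) //.
  suff /eq_enum -> : [pred E | pe E == Vinf] =i frontier l by [].
  move=> E; rewrite !inE.
  have -> : (if E is inl e then e \in l else true) = true.
    by case: E => // e; rewrite (perm_mem lP) mem_enum.
  apply/eqP/hasPn => [-> e _|nE]; first exact: c_inf.
  apply/eqP; apply: contraT => /c_surj[e ce].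
  by have := nE e; rewrite (perm_mem lP) mem_enum ce eqxx => /(_ isT).
apply: eqs_trans (bigwedge_perm pulled_homog s's) _; left.
rewrite pullback_bigwedge big_seq [RHS]big_seq; apply: eq_bigr => E.
by rewrite (perm_mem s_root) mem_enum inE /pulled => /eqP->.
Qed.

(** After the edge vectors, contract with the r basis vectors of N. On the leaf side this exhausts
    all coordinates and reads the top coefficient; on the root side [path_mx u Vinf] is the
    projection to N, and only a constant term remains, which a pullback preserves. *)
Lemma root_wedge_coef :
  eq_up_to_sign ((\big[@wedge r/ext_one r]_(E <- s) alpha E) setT)
                ((\big[@wedge n/ext_one n]_i pulled (inr i)) setT).
Proof.
have [l lP lE] := root_wedge; set beta := \big[_/_]_(E <- s) _ in lE *.
set T := \big[_/_]_i _ in lE *.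
pose lr := map (lshift #|cedge G|) (enum 'I_r).
pose le := map (fun e => rshift r (enum_rank e)) l.
have full : [set j in lr ++ le] :|: set0 = setT.
  apply/setP => j; rewrite setU0 !inE mem_cat; apply/orP.
  case: (split_ordP j) => k ->; [left | right].
    by apply/map_f; rewrite mem_enum.
  apply/mapP; exists (enum_val k); last by rewrite enum_valK.
  by rewrite (perm_mem lP) mem_enum.
have := @contract_deltas _ (lr ++ le) T set0; rewrite full => H.
apply: eqs_sym; apply: eqs_trans (eqs_sym (H _ _)) _ => {H}.
- have lr_uniq : uniq lr by rewrite (map_inj_uniq (@lshift_inj _ _)) enum_uniq.
  have le_uniq : uniq le.
    rewrite map_inj_uniq ?(perm_uniq lP) ?enum_uniq //.
    by move=> e e' /rshift_inj/enum_rank_inj.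
  rewrite cat_uniq lr_uniq le_uniq andbT /=.
  apply/hasPn => j /mapP[e _ ->]; apply/mapP => -[k _] /eqP.
  by rewrite eq_rlshift.
- by move=> j _; rewrite inE.
rewrite foldr_cat [foldr _ T le]foldr_map.
apply: eqs_trans (eqs_coef _ (contracts_raddf _ _ lE)) _.
rewrite /lr foldr_map.
have -> b : foldr (fun j => contract (delta_mx 0 (lshift #|cedge G| j)))
      (pullback (path_mx u Vinf) b) (enum 'I_r) =
    pullback (path_mx u Vinf) (foldr (fun j => contract (delta_mx 0 j)) b (enum 'I_r)).
  elim: (enum _) => //= j t ->; rewrite contract_pullback -rowE; congr (pullback _ (contract _ _)).
  by apply/rowP => k; rewrite mxE /path_mx col_mxEu !mxE eqxx eq_sym.
rewrite pullback_coef0.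
apply: eqs_trans (contract_deltas _ (enum_uniq _) _) _; first by move=> j _; rewrite inE.
suff -> : [set j in enum 'I_r] :|: set0 = setT by left.
by apply/setP => j; rewrite !inE mem_enum.
Qed.

(** The projection to N has a section, so the degree of the form at Vinf can be read from its
    pullback, where #E contractions have lowered the degree from r + #E to r. *)
Lemma root_wedge_homogeneous : homogeneous n (\big[@wedge n/ext_one n]_i pulled (inr i)) ->
  homogeneous r (\big[@wedge r/ext_one r]_(E <- s) alpha E).
Proof.
move=> hT; have [l lP lE] := root_wedge.
set beta := \big[_/_]_(E <- s) _ in lE *.
have -> : beta = pullback (row_mx 1%:M 0 : 'M_(r, n)) (pullback (path_mx u Vinf) beta).
  by rewrite pullback_comp /path_mx mul_row_col mul1mx mul0mx addr0 pullback_id.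
apply: homogeneous_pullback; apply: homogeneous_eqs (eqs_sym lE) _.
have := @homogeneous_contracts _ _ edge_vec l _ _ hT.
by rewrite (perm_size lP) -cardE addnK.
Qed.

End Frontier.
(** * The multiplicity formula *)

Section PolyvectorFields.
Variable r : nat.
Implicit Types (n : 'rV[int]_r) (a b : ext r).

Lemma pv_mulE n1 n2 a b :
  pv_mul (zmon n1 a) (zmon n2 b) = zmon (n1 + n2) (wedge a b).
Proof.
rewrite /pv_mul /zmon !msuppU; have [->|_] := eqVneq a 0.
  by rewrite big_nil wedge0x monalgU0.
rewrite big_seq_fset1; have [->|_] := eqVneq b 0.
  by rewrite big_nil wedgex0 monalgU0.
by rewrite big_seq_fset1 !mcoeffUU.
Qed.

Lemma ell1E n a : ell1 (zmon n a) = zmon n (contract n a).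
Proof.
rewrite /ell1 /zmon msuppU; have [->|_] := eqVneq a 0.
  by rewrite big_nil raddf0 monalgU0.
by rewrite big_seq_fset1 mcoeffUU.
Qed.

Lemma pv_prodE (J : eqType) (s : seq J) (zeta : J -> polyvec r) (n : J -> 'rV[int]_r)
    (alpha : J -> ext r) : {in s, forall E, zeta E = zmon (n E) (alpha E)} ->
  pv_prod [seq zeta E | E <- s] =
  zmon (\sum_(E <- s) n E) (\big[@wedge r/ext_one r]_(E <- s) alpha E).
Proof.
rewrite /pv_prod; elim: s => [|E s IHs] zE; first by rewrite !big_nil.
rewrite /= !big_cons IHs => [|E' E's]; last by apply: zE; rewrite inE E's orbT.
by rewrite zE ?mem_head // pv_mulE.
Qed.

Lemma eqs_zmon n a (x : polyvec r) : eq_up_to_sign x (zmon n a) ->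
  exists2 b, x = zmon n b & eq_up_to_sign b a.
Proof.
case=> ->; first by exists a => //; left.
by exists (- a); [rewrite /zmon monalgUN | right].
Qed.

End PolyvectorFields.

(** The top exterior power has rank one, so a primitive element is the basis form up to sign. *)
Lemma ext_pairing_primitive r (Omega beta : ext r) :
  homogeneous r Omega -> primitive Omega -> `|ext_pairing Omega beta| = `|beta setT|.
Proof.
move=> hO O_prim; have OE := homogeneous_top hO.
have O1 : `|Omega setT|%N = 1%N.
  case: (intP (Omega setT)) OE => [|k|k] OE.
  - by apply: (O_prim _ 0); rewrite OE mulr0z mul0rn.
  - by apply: (O_prim _ (ext_basis setT)); rewrite {1}OE pmulrn.
  apply: (O_prim _ (- ext_basis setT)).
  by rewrite {1}OE mulrNz mulNrn pmulrn abszN.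
rewrite /ext_pairing (bigD1 setT) //= big1 ?addr0 => [|S ST]; last first.
  by rewrite OE ext_mulrzE ffunE (negPf ST) !mul0r.
have O1' : `|Omega setT| = 1 by lia.
by rewrite normrM O1' mul1r.
Qed.

(** * The equations of the constraints as columns of one matrix *)

Section ConstraintMatrix.
Variables (I : finType) (r : nat) (cd : I -> nat) (B : forall i, 'M[int]_(r, cd i)).
Local Notation colT := {i : I & 'I_(cd i)}.

(** The matrix of x |-> (x P_i)_i into the product of the N/L_N(A_i), each identified with Z^{cd i}
    by B_i. A column is a pair (i, k): the k-th equation of A_i. *)
Definition constraint_mx n (P : I -> 'M[int]_(n, r)) : 'M[int]_(n, #|{: colT}|) :=
  \matrix_(a, b) (P (tag (enum_val b)) *m B (tag (enum_val b))) a (tagged (enum_val b)).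

Lemma card_colT : #|{: colT}| = (\sum_i cd i)%N.
Proof. by rewrite card_tagged sumnE big_map big_enum; apply: eq_bigr => i _; rewrite card_ord. Qed.

Lemma constraint_mxM n m (A : 'M[int]_(n, m)) (P : I -> 'M[int]_(m, r)) :
  constraint_mx (fun i => A *m P i) = A *m constraint_mx P.
Proof.
apply/matrixP => a b; rewrite mxE [RHS]mxE -mulmxA mxE.
by apply: eq_bigr => k _; rewrite [constraint_mx _ _ _]mxE.
Qed.

Lemma bigwedge_mulrn n (J : Type) (s : seq J) (F : J -> ext n) (w : J -> nat) :
  \big[@wedge n/ext_one n]_(i <- s) (F i *+ w i) =
  (\big[@wedge n/ext_one n]_(i <- s) F i) *+ \prod_(i <- s) w i.
Proof.
elim: s => [|j s IHs]; first by rewrite !big_nil.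
rewrite !big_cons IHs raddfMn /= mulrnA; congr (_ *+ _).
by rewrite !pmulrn wedgeMz.
Qed.

(** Each factor is the wedge of the columns with tag i, times its weight. Concatenating them gives
    all columns in some order, which may differ from that of the enumeration by a sign. *)
Lemma constraint_wedge n (P : I -> 'M[int]_(n, r)) (alpha : I -> ext r) (w : I -> nat) :
    (forall i, eq_up_to_sign (alpha i)
      ((\big[@wedge r/ext_one r]_(k < cd i) ext_covector (col k (B i))) *+ w i)) ->
  eq_up_to_sign ((\big[@wedge n/ext_one n]_i pullback (P i) (alpha i)) setT)
    (vol (constraint_mx P) *+ \prod_i w i).
Proof.
move=> alphaE; pose F i : ext n := \big[@wedge n/ext_one n]_(k < cd i)
  ext_covector (col k (P i *m B i)).
have FE : eq_up_to_sign (\big[@wedge n/ext_one n]_i pullback (P i) (alpha i))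
    ((\big[@wedge n/ext_one n]_i F i) *+ \prod_i w i).
  rewrite -bigwedge_mulrn; apply: eqs_bigwedge => i _.
  apply: eqs_trans (eqs_raddf (pullback (P i)) (alphaE i)) _.
  by rewrite raddfMn /= pullback_colwedge; left.
apply: eqs_trans (eqs_coef _ FE) _; rewrite ffunMnE.
suff : eq_up_to_sign (\big[@wedge n/ext_one n]_i F i)
    (\big[@wedge n/ext_one n]_(b < #|{: colT}|) ext_covector (col b (constraint_mx P))).
  by case=> ->; [left | right; rewrite ffunE mulNrn].
pose G (x : colT) : ext n := ext_covector (col (tagged x) (P (tag x) *m B (tag x))).
pose s := flatten [seq [seq Tagged (fun i => 'I_(cd i)) k | k <- index_enum 'I_(cd i)]
                  | i <- index_enum I].
have -> : \big[@wedge n/ext_one n]_i F i = \big[@wedge n/ext_one n]_(x <- s) G x.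
  by rewrite big_flatten big_map; apply: eq_bigr => i _; rewrite big_map.
have -> : \big[@wedge n/ext_one n]_(b < #|{: colT}|) ext_covector (col b (constraint_mx P)) =
    \big[@wedge n/ext_one n]_(x <- enum {: colT}) G x.
  (* Indexing the enumeration needs a default element; without columns both products are empty. *)
  have [x0 _|e0] := pickP (xpredT : pred colT); last first.
    rewrite [LHS]big_pred0 => [|b]; last by have := e0 (enum_val b).
    by rewrite (size0nil (s := enum _)) ?big_nil // -cardE; apply: eq_card0.
  rewrite (big_nth x0) -cardE big_mkord; apply: eq_bigr => b _.
  rewrite -(enum_val_nth x0) /G; congr ext_covector.
  by apply/colP => a; rewrite !mxE.
apply: bigwedge_perm => [x|]; first by exists 1%N; apply: homogeneous_covector.
apply: uniq_perm; rewrite ?enum_uniq //.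
  apply: allpairs_uniq_dep => [|i _|[i k] [j l] _ _ //]; exact: index_enum_uniq.
move=> [i k]; rewrite mem_enum inE; apply/allpairsPdep; exists i, k.
by rewrite !mem_index_enum.
Qed.

End ConstraintMatrix.

(** * The index of Phi as a volume *)

Section LatticeIndex.
Variables (R : realType) (r : nat) (I : finType) (D : I -> 'M[rat]_r).
Variables (cd : I -> nat) (B : forall i, 'M[int]_(r, cd i)).
Hypothesis B_perp : forall i, perp_basis R (D i) (B i).
Variables (Gam : trop_curve R r I) (Vinf : vert Gam).
Variables (c q : cedge Gam -> vert Gam) (d : vert Gam -> nat).
Hypotheses (cqP : forall e, joins e (c e) (q e)) (dP : forall e, (d (q e) < d (c e))%N).
Hypotheses (c_inj : injective c) (c_inf : forall e, c e != Vinf).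
Hypothesis c_surj : forall v, v != Vinf -> exists e, c e = v.
Local Notation colT := {i : I & 'I_(cd i)}.
Local Notation n := (r + #|cedge Gam|)%N.

(** The sign comparing [cdir e], which points from [src e] to [tgt e], with the direction from the
    parent end to the child end. *)
Definition orient (e : cedge Gam) : int := if tgt e == c e then 1 else -1.

Lemma orientM e : orient e * orient e = 1.
Proof. by rewrite /orient; case: ifP. Qed.

Lemma cq_neq e : c e != q e.
Proof. by apply: contraTneq (dP e) => ->; rewrite ltnn. Qed.

Lemma orient_diff (M : zmodType) (f : vert Gam -> M) e :
  f (c e) - f (q e) = (f (tgt e) - f (src e)) *~ orient e.
Proof.
rewrite /orient; have /orP[] := cqP e => /andP[/eqP se /eqP te].
  by rewrite te se eq_sym (negPf (cq_neq e)) mulrNz mulr1z opprB.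
by rewrite te se eqxx mulr1z.
Qed.

Lemma path_mxE (u : cedge Gam -> 'rV[int]_r) (x : 'rV[int]_n) v :
  x *m path_mx c q u v =
  lsubmx x + \sum_(e | anc c q v e) x 0 (rshift r (enum_rank e)) *: u e.
Proof.
rewrite -{1}[x]hsubmxK /path_mx mul_row_col mulmx1; congr (_ + _).
apply/rowP => j; rewrite mxE summxE [RHS]big_mkcond /=.
rewrite (reindex (@enum_rank (cedge Gam))) /=; last exact/onW_bij/enum_rank_bij.
by apply: eq_bigr => e _; rewrite !mxE enum_rankK; case: ifP => _ //; rewrite mulr0.
Qed.

Lemma edge_in_LN e (z : 'rV[int]_r) :
  in_LN (@position R r I Gam (tgt e) - @position R r I Gam (src e)) z <->
  exists t, z = t *: cdir e.
Proof.
have [len_gt0 ->] := creal_ok e; apply: in_LN_line; first by rewrite gt_eqF.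
by have := tt_cdir e; case: ifP => _; [left | right].
Qed.

Local Notation cmx := (constraint_mx B).
Local Notation pmx v := (path_mx c q (@cdir _ _ Gam) v).
Local Notation idx := (Tagged (fun i => 'I_(cd i))).

(** Eliminating the edge equations by integration along paths turns membership in the image of Phi
    into membership of the remaining discrepancies at the legs in the row lattice of Q; then
    [subgroup_index_vol] applies. *)
Lemma frakD_vol : n = #|{: colT}| ->
  frakD D Gam = `|vol (cmx (fun i => pmx (Defs.root Gam i)))|%N.
Proof.
move=> nC; set Q := cmx _.
pose G := ({ffun cedge Gam -> 'rV[int]_r} * {ffun I -> 'rV[int]_r})%type.
(* Integrate [g.1] along the tree, starting from 0 at Vinf: [corr g i] is what remains of [g.2 i] at
   the root of the leg i. *)
pose corr (g : G) (i : I) : 'rV[int]_r :=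
  g.2 i - \sum_(e | anc c q (Defs.root Gam i) e) g.1 e *~ orient e.
pose f (g : G) : 'rV[int]_#|{: colT}| :=
  \row_b (corr g (tag (enum_val b)) *m B (tag (enum_val b))) 0 (tagged (enum_val b)).
have QE x i (k : 'I_(cd i)) : (x *m Q) 0 (enum_rank (idx k)) =
    (x *m pmx (Defs.root Gam i) *m B i) 0 k.
  rewrite -mulmxA mxE [RHS]mxE; apply: eq_bigr => a _; congr (_ * _).
  by rewrite mxE enum_rankK.
have fE g i (k : 'I_(cd i)) : f g 0 (enum_rank (idx k)) = (corr g i *m B i) 0 k.
  by rewrite mxE enum_rankK.
have eq_rows (y z : 'rV[int]_#|{: colT}|) : (forall i (k : 'I_(cd i)),
    y 0 (enum_rank (idx k)) = z 0 (enum_rank (idx k))) -> y = z.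
  move=> yz; apply/rowP => b; rewrite -[b]enum_valK.
  by case: (enum_val b) => i k; apply: yz.
have corrB g h i : corr (g - h) i = corr g i - corr h i.
  rewrite /corr !ffunE.
  under eq_bigr => e _ do rewrite !ffunE mulrzBl.
  by rewrite sumrB !opprB addrACA [RHS]addrACA; congr (_ + _); apply: addrC.
apply: (@subgroup_index_vol _ _ _ _ Q f nC) => [g h|y|g].
- apply: eq_rows => i k; rewrite fE corrB mulmxBl mxE [X in _ + X]mxE -!fE.
  by rewrite [RHS]mxE [X in _ = _ + X]mxE.
(* Zero edge components already suffice for surjectivity, as the left inverse of B_i lifts arbitrary
   coordinates of N/L_N(A_i). *)
- have C i : {Ci | Ci *m B i = 1%:M} by apply/boolp.cid/perp_basis_linv/(B_perp i).
  pose yi i := \row_(k < cd i) y 0 (enum_rank (idx k)).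
  exists ([ffun=> 0], [ffun i => yi i *m sval (C i)]); apply: eq_rows => i k.
  rewrite fE /corr ffunE /= big1 ?subr0 => [|e _]; last by rewrite ffunE mul0rz.
  by rewrite -mulmxA (svalP (C i)) mulmx1 mxE.
split=> [[H [HE Hi]]|[x xE]].
  have /boolp.choice[t tE] : forall e, exists t, g.1 e - (H (tgt e) - H (src e)) = t *: cdir e.
    by move=> e; apply/edge_in_LN.
  (* Here t_e measures the given edge value minus the increment of H, whereas x has to add lengths
     to the given value; hence the minus sign. The factor [orient] passes from src and tgt to parent
     and child. *)
  pose x : 'rV[int]_n := row_mx (H Vinf) (\row_k - (t (enum_val k) * orient (enum_val k))).
  have xE e : x 0 (rshift r (enum_rank e)) = - (t e * orient e).
    by rewrite /x row_mxEr mxE enum_rankK.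
  exists x; apply: eq_rows => i k; rewrite fE QE.
  have HB : (g.2 i - H (Defs.root Gam i)) *m B i = 0.
    by apply/(in_LN_perp_basis _ (B_perp i)).
  congr (fun_of_matrix _ 0 k); apply/eqP; rewrite -subr_eq0 -mulmxBl -HB; apply/eqP.
  congr (_ *m _); rewrite /corr path_mxE row_mxKl -!addrA; congr (_ + _).
  rewrite -!opprD; congr (- _); rewrite addrCA -big_split /=.
  rewrite [RHS](path_sum dP c_inj c_inf c_surj (f := H)
    (h := fun e => g.1 e *~ orient e + x 0 (rshift r (enum_rank e)) *: cdir e)) // => e.
  rewrite orient_diff xE scaleNr -[_ * _]mulrzz -scalerMzl -tE -mulrzBl.
  by rewrite subKr.
(* Conversely, H is integrated from the prescribed edge values, corrected by the lengths in x. *)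
pose H : {ffun vert Gam -> 'rV[int]_r} := [ffun v => lsubmx x + \sum_(e | anc c q v e)
  (g.1 e *~ orient e + x 0 (rshift r (enum_rank e)) *: cdir e)].
exists H; split=> [e|i].
  apply/edge_in_LN; exists (- (x 0 (rshift r (enum_rank e)) * orient e)).
  rewrite -[H (tgt e) - _]mulr1z -(orientM e) mulrzA -orient_diff !ffunE.
  rewrite (sum_anc_child dP c_inj c_inf c_surj) [_ + (_ + _)]addrCA addrK.
  rewrite mulrzDl -mulrzA orientM mulr1z opprD addrA subrr sub0r.
  by rewrite scaleNr scalerMzl mulrzz.
apply/(in_LN_perp_basis _ (B_perp i)); rewrite ffunE.
have : corr g i *m B i = x *m pmx (Defs.root Gam i) *m B i.
  by apply/rowP => k; rewrite -fE -QE xE.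
move/eqP; rewrite -subr_eq0 -mulmxBl => /eqP <-; congr (_ *m _).
rewrite /corr path_mxE -!addrA; congr (_ + _).
by rewrite -!opprD; congr (- _); rewrite [RHS]addrCA -big_split.
Qed.

End LatticeIndex.
Section Flow.
Variables (R : realType) (r : nat) (I : finType) (Delta : I -> 'rV[int]_r).
Variables (Gam : trop_curve R r I) (Vinf : vert Gam).
Hypothesis DeltaE : forall i, ldir Gam i *+ lweight Gam i = Delta i.
Variables (c q : cedge Gam -> vert Gam) (d : vert Gam -> nat).
Hypotheses (cqP : forall e, joins e (c e) (q e)) (dP : forall e, (d (q e) < d (c e))%N).
Hypotheses (c_inj : injective c) (c_inf : forall e, c e != Vinf).
Hypothesis c_surj : forall v, v != Vinf -> exists e, c e = v.
Local Notation n := (r + #|cedge Gam|)%N.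
Local Notation pe := (parent_end q).

(* [flow_dir E] is the exponent of [zeta E], which points away from [Vinf]. *)
Definition flow_weight (e : cedge Gam) : int := (cweight e)%:Z * orient c e.

Definition flow_dir (E : cedge Gam + I) : 'rV[int]_r :=
  match E with inl e => flow_weight e *: cdir e | inr i => Delta i end.

(** This is the balancing condition, sorted by the flow instead of by src and tgt. For v distinct
    from Vinf the right side is the exponent of the outgoing edge; at Vinf it is empty, so the final
    product has exponent 0. *)
Lemma flow_balanced v :
  \sum_(E | pe E == v) flow_dir E = \sum_(e | c e == v) flow_dir (inl e).
Proof.
rewrite big_sumType /=.
have <- : \sum_(i | Defs.root Gam i == v) ldir Gam i *+ lweight Gam i =
    \sum_(i | Defs.root Gam i == v) Delta i by apply: eq_bigr.
have /eqP := tt_balanced v; rewrite addr_eq0 => /eqP/(congr1 -%R); rewrite opprK => <-.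
apply/eqP; rewrite -subr_eq0.
rewrite [\sum_(e | src e == v) _]big_mkcond [\sum_(e | tgt e == v) _]big_mkcond.
rewrite [\sum_(e | q e == v) _]big_mkcond [\sum_(e | c e == v) _]big_mkcond -!sumrB /=.
rewrite big1 // => e _; rewrite /flow_weight /orient.
have cq := cq_neq dP e; have /orP[] := cqP e => /andP[/eqP-> /eqP->].
  rewrite [q e == c e]eq_sym (negPf cq) mulrN1 scaleNr -scaler_nat natz.
  by case: eqP => _; case: eqP => _; rewrite ?(subrr, subr0, sub0r, opprK, addNr, oppr0).
rewrite eqxx mulr1 -scaler_nat natz.
by case: eqP => _; case: eqP => _; rewrite ?(subrr, subr0, sub0r, opprK, addNr, oppr0).
Qed.

Variable zeta : cedge Gam + I -> polyvec r.
Hypothesis zeta_leaf : forall i, exists2 a, zeta (inr i) = zmon (Delta i) a &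
  exists p, homogeneous p a.
Hypothesis zeta_flow : forall (v : vert Gam) (e : cedge Gam), v != Vinf -> flows_out Vinf v e ->
  exists2 s, perm_eq s (enum (flows_into Vinf v))
           & eq_up_to_sign (zeta (inl e)) (ell [seq zeta E | E <- s]).

Definition flow_form (E : cedge Gam + I) : ext r := mcoeff (flow_dir E) (zeta E).

Lemma flow_step e : exists2 s, perm_eq s (enum [pred E | pe E == c e]) &
  {in s, forall E, zeta E = zmon (flow_dir E) (flow_form E)} ->
  zeta (inl e) = zmon (flow_dir (inl e)) (flow_form (inl e)) /\
  eq_up_to_sign (flow_form (inl e))
    (contract (flow_dir (inl e)) (\big[@wedge r/ext_one r]_(E <- s) flow_form E)).
Proof.
have [|s sP sE] := zeta_flow (c_inf e) (e := e).
  by rewrite (flows_outE cqP dP c_inj c_inf c_surj).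
have sP' : perm_eq s (enum [pred E | pe E == c e]).
  rewrite (perm_trans sP) // (eq_enum (B := [pred E | pe E == c e])) // => E.
  by rewrite !inE -(flows_intoE cqP dP c_inj c_inf c_surj).
exists s => // zE; have sum_s : \sum_(E <- s) flow_dir E = flow_dir (inl e).
  rewrite (perm_big _ sP') big_enum flow_balanced.
  by rewrite (eq_bigl (pred1 e)) ?big_pred1_eq // => e'; rewrite (inj_eq c_inj).
move: sE; rewrite /ell (pv_prodE zE) ell1E sum_s => /eqs_zmon[b zb bE].
have fE : flow_form (inl e) = b by rewrite /flow_form zb mcoeffUU.
by rewrite fE.
Qed.

Lemma flow_formP E : zeta E = zmon (flow_dir E) (flow_form E) /\
  exists p, homogeneous p (flow_form E).
Proof.
case: E => [e|i]; last first.
  have [a aE [p ha]] := zeta_leaf i; rewrite /flow_form aE mcoeffUU.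
  by split=> //; exists p.
(* Induction on the height below the maximal depth: the compact edges flowing into [c e] have deeper
   child ends than e. *)
pose M := \max_v d v; have [m] := ubnP (M - d (c e)).
elim: m => // m IHm in e *; rewrite ltnS => Mm.
have [s sP sE] := flow_step e.
have IHs E : E \in s -> zeta E = zmon (flow_dir E) (flow_form E) /\
    exists p, homogeneous p (flow_form E).
  rewrite (perm_mem sP) mem_enum inE; case: E => [e' /= /eqP qe'|i _]; last first.
    have [a aE [p ha]] := zeta_leaf i; rewrite /flow_form aE mcoeffUU.
    by split=> //; exists p.
  apply: IHm; apply: leq_trans Mm; have := dP e'; rewrite qe'.
  by have := leq_bigmax (F := d) (c e'); rewrite -/M; lia.
have [zE aE] := sE (fun E Es => proj1 (IHs E Es)); split=> //.
have [p hp] : exists p, homogeneous p (\big[@wedge r/ext_one r]_(E <- s) flow_form E).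
  elim: (s) IHs => [|E t IHt] IHs; first by exists 0%N; rewrite big_nil; apply: homogeneous1.
  have [|p hp] := IHt; first by move=> E' E't; apply: IHs; rewrite inE E't orbT.
  have [_ [p' hp']] := IHs E (mem_head _ _).
  by exists (p' + p)%N; rewrite big_cons; apply: homogeneous_wedge.
by exists p.-1; apply: homogeneous_eqs aE _; apply: homogeneous_contract.
Qed.

Lemma flow_formE e : exists2 s, perm_eq s (enum [pred E | pe E == c e]) &
  eq_up_to_sign (flow_form (inl e))
    (contract (flow_dir (inl e)) (\big[@wedge r/ext_one r]_(E <- s) flow_form E)).
Proof.
have [s sP sE] := flow_step e; exists s => //.
by have [] := sE (fun E _ => proj1 (flow_formP E)).
Qed.

Definition edge_scale_mx (z : cedge Gam -> int) : 'M[int]_n :=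
  diag_mx (row_mx (const_mx 1) (\row_k z (enum_val k))).

(** Scaling the direction of an edge amounts to rescaling its length coordinate; for [flow_weight]
    the volume of the diagonal matrix contributes the product of the weights. *)
Lemma path_mx_flow (u : cedge Gam -> 'rV[int]_r) (z : cedge Gam -> int) v :
  path_mx c q (fun e => z e *: u e) v =
  edge_scale_mx z *m path_mx c q u v.
Proof.
rewrite /edge_scale_mx mul_diag_mx; apply/matrixP => a j; rewrite [RHS]mxE /path_mx.
case: (split_ordP a) => k ->.
  by rewrite row_mxEl !col_mxEu [const_mx _ _ _]mxE mul1r.
by rewrite row_mxEr !col_mxEd !mxE; case: ifP => _; rewrite ?mulr0 // mxE.
Qed.

Lemma vol_flow_diag :
  `|vol (edge_scale_mx flow_weight)|%N =
  (\prod_(e : cedge Gam) cweight e)%N.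
Proof.
rewrite vol_diag => [|i j ij]; last by rewrite mxE (negPf ij).
rewrite /edge_scale_mx big_split_ord /= big1 => [|k _]; last by rewrite mxE eqxx row_mxEl mxE.
rewrite mul1r (big_morph absz abszM (erefl _)).
rewrite (reindex (@enum_rank (cedge Gam))) /=; last exact/onW_bij/enum_rank_bij.
apply: eq_bigr => e _; rewrite mxE eqxx row_mxEr mxE enum_rankK /flow_weight /orient.
by case: ifP => _; rewrite ?mulr1 ?mulrN1 ?abszN.
Qed.

End Flow.

Theorem theorem5p1 (R : realType) (r : nat) (I : finType)
    (Delta : I -> 'rV[int]_r) (D : I -> 'M[rat]_r) (w : I -> nat)
    (Psi : I -> nat) (w_gt0 : forall i, (0 < w i)%N) :
  for_generic (fun a : {ffun I -> 'rV[R]_r} =>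
    forall (Gam : trop_curve R r I) (Vinf : vert Gam)
      (zeta : cedge Gam + I -> polyvec r) (s : seq (cedge Gam + I))
      (Omega : ext r),
    in_moduli 0 Delta a D Psi Gam ->
    rigid D Gam ->
    flow_elements D w Delta Vinf zeta ->
    perm_eq s (enum (incident Vinf)) ->
    homogeneous r Omega -> primitive Omega ->
    exists beta : ext r,
      [/\ homogeneous r beta,
          pv_prod [seq zeta E | E <- s] = zmon 0 beta
        & (mult D w Gam)%:Z = `|ext_pairing Omega beta|]).
Proof.
exists [::] => // a _ Gam Vinf zeta s Omega [genus0 DeltaE _ _] [[_ vgenus0 _] codimD].
move=> [zeta_leaf zeta_flow] sP hO O_prim.
have [c [q [d [cqP dP c_inj c_inf c_surj]]]] :=
  rooted_tree Vinf (@tt_connected _ _ Gam) (card_vert_tree vgenus0 genus0).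
(* The size and the basis are chosen together, as the type of the basis matrix depends on its number
   of columns. *)
have /boolp.choice[cB cBP] : forall i, exists cB : {k & 'M[int]_(r, k)},
    perp_basis R (D i) (projT2 cB) /\ exists2 alpha, zeta (inr i) = zmon (Delta i) alpha &
    eq_up_to_sign alpha ((\big[@wedge r/ext_one r]_(k < projT1 cB)
      ext_covector (col k (projT2 cB))) *+ w i).
  move=> i; have [alpha [k [B [pB aE]]] zE] := zeta_leaf i.
  by exists (existT _ k B); split=> //; exists alpha.
pose cd i := projT1 (cB i); pose B i : 'M[int]_(r, cd i) := projT2 (cB i).
have B_perp i : perp_basis R (D i) (B i) by have [] := cBP i.
have leaf i : exists2 alpha, zeta (inr i) = zmon (Delta i) alpha &
    eq_up_to_sign alpha
      ((\big[@wedge r/ext_one r]_(k < cd i) ext_covector (col k (B i))) *+ w i).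
  by have [] := cBP i.
have homog_leaf i alpha : eq_up_to_sign alpha
      ((\big[@wedge r/ext_one r]_(k < cd i) ext_covector (col k (B i))) *+ w i) ->
    homogeneous (cd i) alpha.
  move=> aE; apply: homogeneous_eqs aE _; rewrite pmulrn; apply: homogeneousMz.
  exact: homogeneous_colwedge.
have leaf_homog i : exists2 alpha, zeta (inr i) = zmon (Delta i) alpha &
    exists p, homogeneous p alpha.
  by have [alpha zE /homog_leaf aE] := leaf i; exists alpha => //; exists (cd i).
(* Rigidity equates the number of conditions with the number of parameters, so the constraint matrix
   is square. *)
have sum_cd : (\sum_i cd i = r + #|cedge Gam|)%N.
  move: codimD; rewrite (dtrop_tree vgenus0 genus0) => -[<-].
  by apply: eq_bigr => i _; rewrite (codim_perp_basis (B_perp i)).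
have formP := flow_formP DeltaE cqP dP c_inj c_inf c_surj leaf_homog zeta_flow.
have formE := flow_formE DeltaE cqP dP c_inj c_inf c_surj leaf_homog zeta_flow.
set alpha := flow_form _ _ _ in formP formE.
have alpha_leaf i : eq_up_to_sign (alpha (inr i))
    ((\big[@wedge r/ext_one r]_(k < cd i) ext_covector (col k (B i))) *+ w i).
  by have [alpha' zE aE] := leaf i; rewrite /alpha /flow_form zE mcoeffUU.
have sP' : perm_eq s (enum [pred E | parent_end q E == Vinf]).
  rewrite (perm_trans sP) // (eq_enum (B := [pred E | parent_end q E == Vinf])) // => E.
  by rewrite !inE -(incident_root cqP c_inf).
have alpha_homog E : exists p, homogeneous p (alpha E) by have [] := formP E.
exists (\big[@wedge r/ext_one r]_(E <- s) alpha E); split.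
- apply: (root_wedge_homogeneous dP c_inj c_inf c_surj alpha_homog formE sP').
  rewrite -{2}sum_cd; apply: homogeneous_bigwedge => i.
  exact/homogeneous_pullback/homog_leaf/alpha_leaf.
- rewrite (pv_prodE (fun E _ => proj1 (formP E))) (perm_big _ sP') big_enum.
  rewrite (flow_balanced DeltaE cqP dP) [\sum_(e | _) _]big_pred0 // => e.
  by apply/negbTE/c_inf.
rewrite ext_pairing_primitive //.
have := root_wedge_coef dP c_inj c_inf c_surj alpha_homog formE sP'.
move=> /eqs_trans/(_ (constraint_wedge _ alpha_leaf))/eqs_norm->.
have nC : (r + #|cedge Gam|)%N = #|{: {i : I & 'I_(cd i)}}| by rewrite card_colT.
(* The forms use the exponents n_e while the index uses the primitive directions; the diagonal
   factor carries the difference. *)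
have -> : constraint_mx B (fun i => path_mx c q
      (fun e => flow_dir Delta c (inl e)) (parent_end q (inr i))) =
    edge_scale_mx (flow_weight c) *m
    constraint_mx B (fun i => path_mx c q (@cdir _ _ Gam) (Defs.root Gam i)).
  by rewrite -constraint_mxM; congr constraint_mx; apply: boolp.funext => i; apply: path_mx_flow.
rewrite volM // -mulr_natr normrM normrM -!abszE vol_flow_diag.
rewrite /mult (frakD_vol B_perp cqP dP c_inj c_inf c_surj nC).
by rewrite natz absz_nat !PoszM [X in X * _]mulrC.
Qed.
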